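(* Let $\Delta$ be a thick compact $m$-gon with $m \geq 3$ and let $C, C'$ be opposite chambers of $\Delta$. Denote by $D_0$ and $D_1$ the two chambers adjacent to (but different from) $C$ in the apartment containing $C$ and $C'$, and by $v_0$ (resp. $v_1$) the common vertex of $C$ and $D_0$ (resp. $D_1$). Let also $E_0$ (resp. $E_1$) be a chamber having vertex $v_0$ (resp. $v_1$) but different from $C$ and $D_0$ (resp. $D_1$). Let finally $U$ and $U'$ be closed subsets of $\mathrm{Cham}\,\Delta$ such that every chamber of $U$ is opposite every chamber of $U'$. Then for all $\varepsilon > 0$, the (possibly empty) set $J_\varepsilon(C,C',U,U',E_0,E_1)$ of all $\varphi \in \mathrm{Auttop}(\Delta)$ satisfying $$\varphi(C) \in U, \qquad \varphi(C') \in U',$$ and, for each $i \in \{0,1\}$, $$\rho(\varphi(C), \varphi(B_{v_i}(D_i, \varepsilon))) \geq \varepsilon, \qquad \rho(\varphi(D_i), \varphi(B_{v_i}(C, \varepsilon))) \geq \varepsilon,$$ $$\rho(\varphi(C), \varphi(E_i)) \geq \varepsilon, \qquad \rho(\varphi(D_i), \varphi(E_i)) \geq \varepsilon,$$ is compact, where $\rho$ is some fixed metric inducing the topology on $\mathrm{Cham}\,\Delta$ and $B_{v}(X, r)$ denotes the open ball in $\mathrm{Cham}(v)$ centered at $X$ and of radius $r$ with respect to $\rho$.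
   Context: An $m$-gon is a spherical building $\Delta$ of rank $2$ and diameter $m$, viewed as a simplicial complex (a graph) with vertex set $\mathrm{Vert}\,\Delta$ and set of chambers (edges) $\mathrm{Cham}\,\Delta$. Panels are the same as vertices; $\mathrm{Cham}(v)$ is the set of chambers containing the vertex $v$; two chambers are adjacent if they share a vertex. Apartments are the circuits with $2m$ vertices (and $2m$ chambers); two chambers are opposite if they are at maximal gallery distance $m$, in which case they lie in a unique common apartment. $\Delta$ is thick if each vertex lies in at least three chambers. $\Delta$ is a compact $m$-gon if $\mathrm{Vert}\,\Delta$ carries a compact (metrizable) topology such that $\mathrm{Cham}\,\Delta$ is closed in $(\mathrm{Vert}\,\Delta)^2$, chambers being viewed as pairs of vertices ordered by type; $\mathrm{Cham}\,\Delta$ gets the induced topology. $\mathrm{Auttop}(\Delta)$ is the group of automorphisms of $\Delta$ that restrict to homeomorphisms of $\mathrm{Vert}\,\Delta$ and of $\mathrm{Cham}\,\Delta$, with the topology induced from the compact-open topology on $C(\mathrm{Cham}\,\Delta,\mathrm{Cham}\,\Delta)$ (equivalently, the topology of uniform convergence on $\mathrm{Cham}\,\Delta$). For a chamber $X$ and a set $Y$ of chambers, $\rho(X,Y)=\inf_{Z\in Y}\rho(X,Z)$. *)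

(* Defs.v *)
(* MathComp-Analysis *)
From HB Require Import structures.
From mathcomp Require Import all_boot all_order all_algebra.
From mathcomp Require Import all_classical all_reals all_analysis.

Set Implicit Arguments.
Unset Strict Implicit.
Unset Printing Implicit Defensive.

Import Order.TTheory GRing.Theory Num.Theory.

Local Open Scope classical_set_scope.
Local Open Scope ring_scope.

Definition is_metric (R : realType) (T : Type) (d : T -> T -> R) : Prop :=
  [/\ forall x y, 0 <= d x y,
      forall x y, d x y = 0 <-> x = y,
      forall x y, d x y = d y x &
      forall x y z, d x z <= d x y + d y z].

Definition metrizes (R : realType) (T : topologicalType) (d : T -> T -> R) :
    Prop :=
  is_metric d /\
  forall (x : T) (A : set T),
    nbhs x A <-> exists2 e : R, 0 < e & [set y | d x y < e] `<=` A.

Definition homeomorphism (S T : topologicalType) (f : S -> T) : Prop :=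
  exists g : T -> S, [/\ cancel f g, cancel g f, continuous f & continuous g].

(* A simplicial complex of dimension at most 1 whose vertices carry a type in
   {0, 1} (false is type 0, true is type 1), vertices of an edge having
   distinct types. *)
Record typed_graph (V : choiceType) := TypedGraph {
  ty : V -> bool;
  adj : rel V;
  adj_sym : symmetric adj;
  adj_ty : forall v w, adj v w -> ty v != ty w
}.

Section Building.
Variables (V : choiceType) (G : typed_graph V).

Definition simplex (s : set V) : Prop :=
  [\/ s = set0,
      exists v, s = [set v] |
      exists v w, adj G v w /\ s = [set v; w]].

Definition circuit (n : nat) (p : seq V) : Prop :=
  [/\ cycle (adj G) p, uniq p & size p = n].

(* The simplices of the subcomplex formed by a circuit. *)
Definition circuit_simplex (p : seq V) (s : set V) : Prop :=
  [\/ s = set0,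
      exists2 v, v \in p & s = [set v] |
      exists2 v, v \in p & s = [set v; next p v]].

Definition circuit_isom (p q : seq V) (f : V -> V) : Prop :=
  [/\ {in p &, injective f},
      f @` [set` p] = [set` q] &
      forall s, s `<=` [set` p] ->
        circuit_simplex p s <-> circuit_simplex q (f @` s)].

(* The building axioms, for the system of apartments consisting of all
   circuits with 2m vertices, which are the Coxeter complexes of the dihedral
   group of order 2m; this fixes the rank 2 and the diameter m.  (The complete
   apartment system is the only one of a spherical building.) *)
Definition polygon (m : nat) : Prop :=
  (forall s t, simplex s -> simplex t ->
     exists p, [/\ circuit m.*2 p, circuit_simplex p s & circuit_simplex p t])
  /\
  (forall p q s t, circuit m.*2 p -> circuit m.*2 q ->
     circuit_simplex p s -> circuit_simplex p t ->
     circuit_simplex q s -> circuit_simplex q t ->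
     exists2 f, circuit_isom p q f & forall x, (s `|` t) x -> f x = x).

Definition chamber_set : set (V * V) :=
  [set c | [/\ ty G c.1 = false, ty G c.2 = true & adj G c.1 c.2]].

Definition is_automorphism (f : V -> V) : Prop :=
  bijective f /\ forall v w, adj G (f v) (f w) = adj G v w.

(* Automorphisms may exchange the two types. *)
Definition automorphism : Type := set_type is_automorphism.

Definition sort_by_type (c : V * V) : V * V :=
  if ty G c.1 then (c.2, c.1) else c.

Lemma chamber_map_subproof (phi : automorphism) (c : set_type chamber_set) :
  sort_by_type (val phi (val c).1, val phi (val c).2) \in chamber_set.
Proof.
case: phi => f /= /set_mem [_ fadj]; case: c => -[v w] /= /set_mem /= [_ _ vw].
apply/mem_set; rewrite /sort_by_type /=.
have fvw : adj G (f v) (f w) by rewrite fadj.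
have := adj_ty fvw; case tv : (ty G (f v)); case tw : (ty G (f w)) => //= _.
by split=> //=; rewrite adj_sym.
Qed.

End Building.

Section Topological.
Variables (V : topologicalType) (G : typed_graph V).

(* Chambers are pairs of vertices ordered by type, with the topology induced
   from V * V. *)
Definition chamber : Type := set_type (chamber_set G).
HB.instance Definition _ := Topological.copy chamber (set_type (chamber_set G)).

Definition has_vertex (v : V) (X : chamber) : bool :=
  (v == (val X).1) || (v == (val X).2).

Definition chamber_adj (X Y : chamber) : bool :=
  ((val X).1 == (val Y).1) || ((val X).2 == (val Y).2).

Definition gallery (n : nat) (X Y : chamber) : Prop :=
  exists s : seq chamber, [/\ path chamber_adj X s, last X s = Y & size s = n].

Definition gallery_dist (X Y : chamber) (n : nat) : Prop :=
  gallery n X Y /\ forall k, (k < n)%N -> ~ gallery k X Y.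

Definition opposite (m : nat) (X Y : chamber) : Prop := gallery_dist X Y m.

Definition chamber_in (p : seq V) (X : chamber) : Prop :=
  circuit_simplex p [set (val X).1; (val X).2].

Definition thick : Prop :=
  forall v : V, exists s : seq chamber,
    [/\ uniq s, size s = 3%N & all (has_vertex v) s].

Definition compact_polygon (R : realType) (m : nat) : Prop :=
  [/\ polygon G m,
      compact [set: V],
      exists d : V -> V -> R, metrizes d &
      closed (chamber_set G)].

Definition chamber_map (phi : automorphism G) (X : chamber) : chamber :=
  exist _ (sort_by_type G (val phi (val X).1, val phi (val X).2))
    (chamber_map_subproof phi X).

Definition bicontinuous_automorphism : set (automorphism G) :=
  [set phi | homeomorphism (val phi : V -> V) /\ homeomorphism (chamber_map phi)].

Definition auttop_action (phi : set_type bicontinuous_automorphism) :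
  {compact-open, chamber -> chamber} := chamber_map (val phi).

(* The group Auttop, with the topology induced from the compact-open one. *)
Definition Auttop : Type := initial_topology auttop_action.
HB.instance Definition _ :=
  Topological.copy Auttop (initial_topology auttop_action).

Definition act (phi : Auttop) (X : chamber) : chamber := auttop_action phi X.

End Topological.

Section Metric.
Variables (R : realType) (V : topologicalType) (G : typed_graph V).
Variable rho : chamber G -> chamber G -> R.

Definition dist_to (X : chamber G) (Y : set (chamber G)) : R :=
  inf [set rho X Z | Z in Y].

Definition panel_ball (v : V) (X : chamber G) (r : R) : set (chamber G) :=
  [set Y | has_vertex v Y /\ rho X Y < r].

(* The index set {0, 1} is bool. *)
Definition J_set (eps : R) (C C' : chamber G) (U U' : set (chamber G))
    (v : bool -> V) (D E : bool -> chamber G) : set (Auttop G) :=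
  [set phi | [/\ U (act phi C), U' (act phi C') &
     forall i : bool,
       [/\ eps <= dist_to (act phi C) (act phi @` panel_ball (v i) (D i) eps),
           eps <= dist_to (act phi (D i)) (act phi @` panel_ball (v i) C eps),
           eps <= rho (act phi C) (act phi (E i)) &
           eps <= rho (act phi (D i)) (act phi (E i))]]].

End Metric.

(* Main.v *)
Require Import Defs.
From mathcomp Require Import all_boot all_order all_algebra.
From mathcomp Require Import all_classical all_reals all_analysis.
From mathcomp Require Import zify lra.

Set Implicit Arguments.
Unset Strict Implicit.
Unset Printing Implicit Defensive.

Import Order.TTheory GRing.Theory Num.Theory.

Local Open Scope classical_set_scope.

(** Let F be an ultrafilter on Auttop that contains the set J, and let g be a map
    from a set with an ultrafilter to Auttop, with values in J almost everywhere.
    The vertices form a compact space, so that every family of vertices has a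
    limit, and the theorem follows from the continuity of convergence
    (linked_continuous, J_continuous): two families x i and y i of vertices have
    the same limit if and only if the families g i (x i) and g i (y i) do.  Indeed
    the pointwise limit of F is then a homeomorphism, F converges to it in the
    compact-open topology, and the closed conditions that define J pass to the
    limit.

    The argument is carried out with vertices and the projection pr x y, the
    neighbour of x closest to y, which is continuous in (x, y) as long as the
    distance is m - 1 (lm_pr).  The building axioms only serve to show that the
    graph has diameter m and that the neighbour of x closest to y is unique when
    the distance is less than m (closer_uniq).

    The heart is a statement on the panel of v = v_i.  Call the vertex of D_i other
    than v zero, and that of C infinity.  Because U and U' are closed and opposite,
    the images of C and C' converge to opposite chambers, so the images of the
    apartment converge to an apartment; the conditions with epsilon say that the
    images of E_i stay away from those of zero and infinity, and that nothing close
    to zero is mapped close to the image of infinity or vice versa.  From the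
    apartment and from E_0 and E_1 one constructs, by iterated projections, a
    subtraction on the panel that vanishes on the diagonal only, and a
    multiplication such that zero times x is zero for finite x, and such that
    multiplication by f is inverted by a division when f is neither zero nor
    infinity and an auxiliary vertex is chosen in dependence on f.  These
    operations commute with automorphisms and with limits.

    If Y tends to zero, then so do its images (third_limit).  This is clear when
    zero is isolated in the panel.  Otherwise, assume that the images tend to
    z, different from zero, and take infinitely many elements close to zero.  Their
    images stay in a compact set without infinity, so for two of them, P and Q, the
    difference of the images divided by z is close to zero.  Then the difference
    of P and Q divided by Y stays away from infinity, and multiplying by Y shows
    that P - Q is zero.  The hypotheses are symmetric in zero and infinity
    (linked_swap) and under inversion of the automorphisms (linked_inv).  With the
    subtraction, it follows that two families in the panel have the same limit if
    and only if their images do (panel_limit).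

    By the perspectivities between opposite vertices and by thickness, this spreads
    from the two panels of C to all panels (spread_step, all_spread), and along
    geodesics to all vertices (spread_eq). *)

(** * Circuits *)

Section Circuits.
Variables (V : choiceType) (G : typed_graph V).

Lemma adj_neq (x y : V) : adj G x y -> x <> y.
Proof. by move=> /adj_ty + exy; rewrite exy eqxx. Qed.

Lemma set2_eq (a b c d : V) :
  [set a; b] = [set c; d] -> a = c /\ b = d \/ a = d /\ b = c.
Proof.
move=> e.
have a_cd : [set c; d] a by rewrite -e; left.
have b_cd : [set c; d] b by rewrite -e; right.
have c_ab : [set a; b] c by rewrite e; left.
have d_ab : [set a; b] d by rewrite e; right.
case: a_cd b_cd c_ab d_ab => /= -> [] /= -> [] /= ? [] /= ?; subst; by [left|right].
Qed.

Lemma simplex_edge (x y : V) : adj G x y -> simplex G [set x; y].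
Proof. by move=> xy; apply: Or33; exists x, y. Qed.

Lemma circuit_simplex_rot n (p : seq V) (s : set V) : uniq p ->
  circuit_simplex (rot n p) s <-> circuit_simplex p s.
Proof.
move=> up; split=> -[?|[v vp ->]|[v vp ->]]; try exact: Or31.
- by apply: Or32; exists v => //; rewrite mem_rot in vp.
- by apply: Or33; exists v; [rewrite mem_rot in vp|rewrite next_rot].
- by apply: Or32; exists v => //; rewrite mem_rot.
- by apply: Or33; exists v; [rewrite mem_rot|rewrite next_rot].
Qed.

Lemma circuit_simplex_rev (p : seq V) (s : set V) : uniq p ->
  circuit_simplex p s -> circuit_simplex (rev p) s.
Proof.
move=> up -[?|[v vp ->]|[v vp ->]]; first exact: Or31.
  by apply: Or32; exists v => //; rewrite mem_rev.
apply: Or33; exists (next p v); first by rewrite mem_rev mem_next.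
by rewrite next_rev // prev_next // setUC.
Qed.

Lemma circuit_rev n (p : seq V) : circuit G n p -> circuit G n (rev p).
Proof.
move=> [cp up sp]; split; last by rewrite size_rev.
  by rewrite rev_cycle; rewrite (eq_cycle (e' := adj G)) // => x y; exact: adj_sym.
by rewrite rev_uniq.
Qed.

(** Rotate the circuit, after reversing it if it runs through the edge the other
    way. *)
Lemma circuit_start n (p : seq V) (x y : V) :
  circuit G n p -> circuit_simplex p [set x; y] -> adj G x y ->
  exists q, circuit G n [:: x, y & q] /\
    forall s, circuit_simplex p s -> circuit_simplex [:: x, y & q] s.
Proof.
have main r : circuit G n r -> x \in r -> y = next r x -> x <> y ->
  exists q, circuit G n [:: x, y & q] /\
    forall s, circuit_simplex r s -> circuit_simplex [:: x, y & q] s.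
  move=> [cr ur sr] xr yr xNy.
  have [i [|z q] rot_r] := rot_to xr.
    by move: yr; rewrite -(next_rot i ur) rot_r /= eqxx => /esym /xNy.
  have yz : y = z by rewrite yr -(next_rot i ur) rot_r /= eqxx.
  exists q; rewrite yz -rot_r; split.
    by split; rewrite ?rot_cycle ?rot_uniq ?size_rot.
  by move=> s /(circuit_simplex_rot i s ur).
move=> cp sxy xy; have xNy := adj_neq xy; have [_ up _] := cp.
case: sxy => [e|[v vp e]|[v vp e]].
- have : [set x; y] x by left.
  by rewrite e.
- have : [set x; y] x by left.
  have : [set x; y] y by right.
  by rewrite e => /= yv xv; case: xNy; rewrite xv yv.
have [[xv yv]|[xv yv]] := set2_eq e; subst.
  exact: main cp vp erefl xNy.
have cr := circuit_rev cp.
have [||q [cq sq]] := main _ cr _ _ xNy.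
- by rewrite mem_rev mem_next.
- by rewrite next_rev // prev_next.
by exists q; split=> // s ps; apply: sq; exact: circuit_simplex_rev.
Qed.

(** As the default value is the first vertex, the index that ends the list stands
    for 0, and no reduction modulo the length is needed. *)
Lemma next_index (x : V) (p : seq V) i : uniq (x :: p) -> i < size (x :: p) ->
  next (x :: p) (nth x (x :: p) i) = nth x (x :: p) i.+1.
Proof. by move=> up ip; rewrite next_nth mem_nth // index_uniq. Qed.

Lemma circuit_simplex_edge (x : V) (p : seq V) (a b : V) :
  uniq (x :: p) -> a <> b -> circuit_simplex (x :: p) [set a; b] ->
  exists2 i, i < size (x :: p) &
    a = nth x (x :: p) i /\ b = nth x (x :: p) i.+1 \/
    b = nth x (x :: p) i /\ a = nth x (x :: p) i.+1.
Proof.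
move=> up aNb [e|[v vp e]|[v vp e]].
- have : [set a; b] a by left.
  by rewrite e.
- have : [set a; b] a by left.
  have : [set a; b] b by right.
  by rewrite e => /= bv av; case: aNb; rewrite av bv.
exists (index v (x :: p)); first by rewrite index_mem.
rewrite -next_index ?index_mem // nth_index //.
by have [[-> ->]|[-> ->]] := set2_eq e; [left|right].
Qed.

Lemma circuit_simplex_next (x : V) (p : seq V) i : uniq (x :: p) ->
  i < size (x :: p) ->
  circuit_simplex (x :: p) [set nth x (x :: p) i; nth x (x :: p) i.+1].
Proof.
move=> up ip; apply: Or33; exists (nth x (x :: p) i); first exact: mem_nth.
by rewrite next_index.
Qed.

Lemma circuit_adj n (x : V) (p : seq V) i : circuit G n (x :: p) -> i < n ->
  adj G (nth x (x :: p) i) (nth x (x :: p) i.+1).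
Proof.
move=> [cp up sp] i_n.
by rewrite -next_index ?sp //; apply: next_cycle; rewrite ?mem_nth ?sp.
Qed.

Lemma circuit_simplex_mem (p : seq V) (s : set V) v :
  circuit_simplex p s -> s v -> v \in p.
Proof.
move=> [->//|[w wp ->] ->//|[w wp ->] [->//|->]].
by rewrite mem_next.
Qed.

End Circuits.

(** * Distance in the graph *)

Section Distance.
Variables (V : choiceType) (G : typed_graph V).

Fixpoint walk n (x y : V) : Prop :=
  if n is k.+1 then exists2 z, walk k x z & adj G z y else x = y.

Lemma circuit_walk n (y : V) (p : seq V) i k : circuit G n (y :: p) ->
  i + k <= n -> walk k (nth y (y :: p) i) (nth y (y :: p) (i + k)).
Proof.
move=> cp; elim: k => [|k IH] ik /=; first by rewrite addn0.
exists (nth y (y :: p) (i + k)); first by apply: IH; lia.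
by rewrite addnS; apply: circuit_adj cp _; lia.
Qed.

(** Distances come from an opaque existence proof, so that conversion never
    unfolds them. *)
Lemma dist_sig : {f : V -> V -> nat | forall x y, (exists n, walk n x y) ->
  walk (f x y) x y /\ forall k, walk k x y -> f x y <= k}.
Proof.
exists (fun x y => xget 0 [set n | walk n x y /\ forall k, walk k x y -> n <= k]).
move=> x y xy; case: xgetP => [_ _ //|no]; exfalso.
have ex : exists n, `[< walk n x y >].
  by have [n ?] := xy; exists n; exact/asboolP.
case: (ex_minnP ex) => n /asboolP {}xy mn; apply: (no n); split=> // k.
by move/asboolP/mn.
Qed.

Definition dist : V -> V -> nat := sval dist_sig.

Lemma walk_cat n k (x y z : V) : walk n x y -> walk k y z -> walk (n + k) x z.
Proof.
elim: k z => [|k IH] z xy /=; first by move=> <-; rewrite addn0.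
by move=> [t yt tz]; rewrite addnS; exists t => //; exact: IH.
Qed.

Lemma walk1 (x y : V) : walk 1 x y <-> adj G x y.
Proof. by split=> [[z <-]|xy] //; exists x. Qed.

Lemma walk_sym n (x y : V) : walk n x y -> walk n y x.
Proof.
elim: n x y => [x y -> //|n IH x y [z xz zy]].
rewrite -add1n; apply: (@walk_cat _ _ _ z); last exact: IH.
by apply/walk1; rewrite adj_sym.
Qed.

Lemma walk_ty n (x y : V) : walk n x y -> (ty G x == ty G y) = ~~ odd n.
Proof.
elim: n y => [y -> |n IH y [z /IH xz /adj_ty zy]] /=; first by rewrite eqxx.
by move: xz zy; case: (ty G x); case: (ty G y); case: (ty G z) => //=; case: odd.
Qed.

Section Connected.
Hypothesis conn : forall x y : V, exists n, walk n x y.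

Lemma distP (x y : V) :
  walk (dist x y) x y /\ forall k, walk k x y -> dist x y <= k.
Proof.
exact: (svalP dist_sig) (conn x y).
Qed.

Lemma dist_walk n (x y : V) : walk n x y -> dist x y <= n.
Proof. by case: (distP x y) => _; apply. Qed.

Lemma distC (x y : V) : dist x y = dist y x.
Proof.
have [? _] := distP x y; have [? _] := distP y x.
by apply/eqP; rewrite eqn_leq !dist_walk //; exact: walk_sym.
Qed.

Lemma dist_triangle (y x z : V) : dist x z <= dist x y + dist y z.
Proof.
have [xy _] := distP x y; have [yz _] := distP y z.
exact/dist_walk/(walk_cat xy yz).
Qed.

Lemma dist0 (x y : V) : dist x y = 0 -> x = y.
Proof. by move=> xy; have [+ _] := distP x y; rewrite xy. Qed.

Lemma dist_ty (x y : V) : (ty G x == ty G y) = ~~ odd (dist x y).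
Proof. have [+ _] := distP x y; exact: walk_ty. Qed.

Lemma dist_adj_le (x y : V) : adj G x y -> dist x y <= 1.
Proof. by move/walk1/dist_walk. Qed.

Lemma dist1 (x y : V) : adj G x y -> dist x y = 1.
Proof.
move=> xy; apply/eqP; rewrite eqn_leq dist_adj_le // lt0n.
by apply/eqP => /dist0 /(adj_neq xy).
Qed.

Lemma adj_dist (x y : V) : dist x y = 1 -> adj G x y.
Proof. by move=> xy; apply/walk1; have [+ _] := distP x y; rewrite xy. Qed.

(** The two types make distances change by exactly one along an edge. *)
Lemma dist_step (x y w : V) : adj G y w ->
  dist w x = (dist y x).+1 \/ dist y x = (dist w x).+1.
Proof.
move=> yw; have yw1 := dist_adj_le yw.
have := dist_triangle y w x; rewrite distC in yw1.
have := dist_triangle w y x; rewrite [dist y w]distC.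
have := dist_ty y x; have := dist_ty w x; have := adj_ty yw.
case: (ty G x); case: (ty G y); case: (ty G w) => //= _ /esym + /esym; lia.
Qed.

Lemma dist_pred (x y : V) : 0 < dist y x ->
  exists2 w, adj G y w & dist y x = (dist w x).+1.
Proof.
rewrite [dist y x]distC; case E: (dist x y) => [//|n] _.
have [+ _] := distP x y; rewrite E => -[w xw wy].
have yw : adj G y w by rewrite adj_sym.
exists w => //; have := dist_walk xw; rewrite distC => wx.
by have := dist_step x yw; rewrite [dist y x]distC E; lia.
Qed.

End Connected.
End Distance.

(** * Distances from the building axioms *)

Section Polygon.
Variables (V : choiceType) (G : typed_graph V) (m : nat).
Hypothesis m_ge3 : 2 < m.
Hypothesis poly : polygon G m.

(** Position of x in the circuits that start with the edge {y, w}.  As a map to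
    the cycle of length 2m, it is the retraction of the building onto an
    apartment, centered at that edge. *)
Definition at_pos (y w : V) (i : nat) (x : V) : Prop :=
  exists q, [/\ circuit G m.*2 [:: y, w & q], i < m.*2 &
                nth y [:: y, w & q] i = x].

(** Follow the circuit: once two consecutive vertices are fixed, the image of the
    next one is the only neighbour left. *)
Lemma circuit_isom_nth (y w : V) (p q : seq V) f :
  circuit G m.*2 [:: y, w & p] -> circuit G m.*2 [:: y, w & q] ->
  circuit_isom [:: y, w & p] [:: y, w & q] f -> f y = y -> f w = w ->
  forall i, i < m.*2 -> f (nth y [:: y, w & p] i) = nth y [:: y, w & q] i.
Proof.
move=> [_ up sp] [_ uq sq] [finj _ fs] fy fw.
suff H i : i.+1 < m.*2 ->
    f (nth y [:: y, w & p] i) = nth y [:: y, w & q] i /\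
    f (nth y [:: y, w & p] i.+1) = nth y [:: y, w & q] i.+1.
  case=> [//|i] im; by case: (H i im).
elim: i => [//|i IH] im; have [fi fi1] := IH (ltnW im); split=> //.
have fI a b : a < m.*2 -> b < m.*2 -> a != b ->
    f (nth y [:: y, w & p] a) <> f (nth y [:: y, w & p] b).
  move=> am bm ab /finj; rewrite !mem_nth ?sp // => /(_ isT isT) /eqP.
  by rewrite nth_uniq ?sp // (negPf ab).
have sub : [set nth y [:: y, w & p] i.+1; nth y [:: y, w & p] i.+2] `<=`
    [set` [:: y, w & p]].
  by move=> x [->|->]; apply: mem_nth; rewrite sp // ltnW.
have /(fs _ sub) {}fs : circuit_simplex [:: y, w & p]
    [set nth y [:: y, w & p] i.+1; nth y [:: y, w & p] i.+2].
  by apply: circuit_simplex_next; rewrite ?sp // ltnW.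
have imE : (f @` [set nth y [:: y, w & p] i.+1; nth y [:: y, w & p] i.+2]) =
   [set nth y [:: y, w & q] i.+1; f (nth y [:: y, w & p] i.+2)].
  by rewrite image_setU !image_set1 -fi1.
rewrite imE in fs.
have ne : nth y [:: y, w & q] i.+1 <> f (nth y [:: y, w & p] i.+2).
  by rewrite -fi1; apply: fI => //; [exact: ltnW|lia].
have [j] := circuit_simplex_edge uq ne fs.
rewrite sq => jm [[ij fj]|[fj ij]].
  move: ij => /eqP; rewrite nth_uniq ?sq //; last exact: ltnW.
  by move=> /eqP ij; rewrite fj -ij.
have [jl|jl] := ltnP j.+1 m.*2.
  move: ij => /eqP; rewrite nth_uniq ?sq //; last exact: ltnW.
  move=> /eqP [ij]; exfalso; apply: (fI i i.+2); rewrite ?fi ?fj ?ij //; lia.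
move: ij; rewrite (nth_default _ (n := j.+1)) ?sq //.
rewrite -[y in RHS]/(nth y [:: y, w & q] 0) => /eqP.
by rewrite nth_uniq ?sq //; lia.
Qed.

(** The second building axiom gives an isomorphism between the two circuits that
    fixes the initial edge and x. *)
Lemma at_pos_uniq (y w x : V) i j :
  adj G y w -> at_pos y w i x -> at_pos y w j x -> i = j.
Proof.
move=> yw [p [cp im px]] [q [cq jm qx]].
have [_ up sp] := cp; have [_ uq sq] := cq.
have first (r : seq V) : circuit G m.*2 [:: y, w & r] ->
    circuit_simplex [:: y, w & r] [set y; w].
  by move=> [_ ur sr]; apply: (@circuit_simplex_next _ y (w :: r) 0).
have vert (r : seq V) k : circuit G m.*2 [:: y, w & r] -> k < m.*2 ->
    circuit_simplex [:: y, w & r] [set nth y [:: y, w & r] k].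
  by move=> [_ _ sr] km; apply: Or32; exists (nth y [:: y, w & r] k); rewrite ?mem_nth ?sr.
have [] := (proj2 poly) _ _ [set y; w] [set x] cp cq.
- exact: first.
- by rewrite -px; exact: vert.
- exact: first.
- by rewrite -qx; exact: vert.
move=> f fpq fix_f.
have fy : f y = y by apply: fix_f; left; left.
have fw : f w = w by apply: fix_f; left; right.
have fx : f x = x by apply: fix_f; right.
have := circuit_isom_nth cp cq fpq fy fw im; rewrite px fx -qx.
by move=> /eqP; rewrite nth_uniq ?sq // => /eqP.
Qed.

Lemma edge_at_pos (y w a b : V) : adj G y w -> adj G a b ->
  exists q i, [/\ circuit G m.*2 [:: y, w & q], i < m.*2 &
    a = nth y [:: y, w & q] i /\ b = nth y [:: y, w & q] i.+1 \/
    b = nth y [:: y, w & q] i /\ a = nth y [:: y, w & q] i.+1].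
Proof.
move=> yw ab.
have [p [cp pyw pab]] := (proj1 poly) _ _ (simplex_edge yw) (simplex_edge ab).
have [q [cq sq]] := circuit_start cp pyw yw.
have [_ uq sz] := cq.
have [i] := circuit_simplex_edge uq (adj_neq ab) (sq _ pab).
by rewrite sz => im H; exists q, i.
Qed.

Definition cyc_next (i : nat) : nat := if i.+1 < m.*2 then i.+1 else 0.

Lemma edge_pos (y w a b : V) : adj G y w -> adj G a b ->
  exists i j, [/\ at_pos y w i a, at_pos y w j b &
                  j = cyc_next i \/ i = cyc_next j].
Proof.
move=> yw ab; have [q [i [cq im H]]] := edge_at_pos yw ab.
have [_ _ sz] := cq.
have at0 k : k < m.*2 -> at_pos y w k (nth y [:: y, w & q] k) by exists q.
have at1 k : k < m.*2 -> at_pos y w (cyc_next k) (nth y [:: y, w & q] k.+1).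
  move=> km; rewrite /cyc_next; case: ltnP => k1; first exact: at0.
  by rewrite nth_default ?sz //; apply: (at0 0); lia.
case: H => -[-> ->].
  by exists i, (cyc_next i); split; [exact: at0|exact: at1|left].
by exists (cyc_next i), i; split; [exact: at1|exact: at0|right].
Qed.

Lemma vert_at_pos (y w x : V) : adj G y w -> exists i, at_pos y w i x.
Proof.
move=> yw.
have vx : simplex G [set x] by apply: Or32; exists x.
have [p [cp pyw px]] := (proj1 poly) _ _ (simplex_edge yw) vx.
have [q [cq sq]] := circuit_start cp pyw yw.
have [_ uq sz] := cq.
have xq : x \in [:: y, w & q] by apply: (circuit_simplex_mem (sq _ px)).
by exists (index x [:: y, w & q]), q; rewrite -{2}sz index_mem nth_index.
Qed.

Lemma polygon_edge (x : V) : exists y, adj G x y.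
Proof.
have vx : simplex G [set x] by apply: Or32; exists x.
have [[|y p] [cp px _]] := (proj1 poly) _ _ vx vx.
  by have := circuit_simplex_mem px (erefl x).
have xp := circuit_simplex_mem px (erefl x).
have [cy _ _] := cp.
by exists (next (y :: p) x); apply: next_cycle.
Qed.

Lemma polygon_conn (x y : V) : exists n, walk G n x y.
Proof.
have [w xw] := polygon_edge x.
have [i [q [cq im <-]]] := vert_at_pos y xw.
have := @circuit_walk _ G m.*2 x (w :: q) 0 i cq; rewrite add0n => /(_ (ltnW im)).
by exists i.
Qed.

Notation d := (dist G).
Let distP' := distP polygon_conn.

(** Distance in the cycle of length 2m. *)
Definition cdist (i j : nat) : nat :=
  minn ((i - j) + (j - i)) (m.*2 - ((i - j) + (j - i))).

(** Retractions do not increase distances. *)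
Lemma cdist_le_walk (y w a b : V) n i j : adj G y w -> walk G n a b ->
  at_pos y w i a -> at_pos y w j b -> cdist i j <= n.
Proof.
move=> yw; elim: n b j => [b j -> pa pb|n IH b j [z az zb] pa pb].
  by rewrite (at_pos_uniq yw pa pb) /cdist; lia.
have [k [j' [pz pb' kj]]] := edge_pos yw zb.
have -> := at_pos_uniq yw pb pb'.
have := IH _ _ az pa pz; move: kj; rewrite /cdist /cyc_next.
have [? [_ im _]] := pa; have [? [_ km _]] := pz; have [? [_ jm _]] := pb'.
by case: ltnP => ?; case: ltnP => ? []; lia.
Qed.

Lemma dist_at_pos (y w x : V) i : adj G y w -> at_pos y w i x ->
  d y x = cdist 0 i /\ cdist 1 i <= d w x.
Proof.
move=> yw px; have [q [cq im xE]] := px; have [_ _ sz] := cq.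
have py : at_pos y w 0 y by exists q; split=> //; lia.
have pw : at_pos y w 1 w by exists q; split=> //; lia.
split; last exact: cdist_le_walk yw (proj1 (distP' w x)) pw px.
apply/eqP; rewrite eqn_leq (cdist_le_walk yw (proj1 (distP' y x)) py px) andbT.
have := @circuit_walk _ G m.*2 y (w :: q) 0 i cq; rewrite xE add0n.
move=> /(_ (ltnW im)) /(dist_walk polygon_conn).
have := @circuit_walk _ G m.*2 y (w :: q) i (m.*2 - i) cq.
rewrite subnKC ?(ltnW im) // => /(_ (leqnn _)).
rewrite xE nth_default ?sz // => /(dist_walk polygon_conn); rewrite (distC polygon_conn).
by rewrite /cdist /=; lia.
Qed.

Lemma dist_le (x y : V) : d x y <= m.
Proof.
have [w xw] := polygon_edge x; have [i yi] := vert_at_pos y xw.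
by have [-> _] := dist_at_pos xw yi; rewrite /cdist; lia.
Qed.

(** Retract onto an apartment centered at the edge {y, w}: w lies on the short
    side towards x, so that w', which retracts to the other neighbour of y in
    the apartment, cannot be closer to x than y. *)
Lemma closer_uniq (x y w w' : V) : d y x < m -> adj G y w -> adj G y w' ->
  d w x < d y x -> d w' x < d y x -> w = w'.
Proof.
move=> yxm yw yw' wx w'x; apply: contrapT => wNw'.
have [k xk] := vert_at_pos x yw; have [q [_ km _]] := xk.
have [i [j [yi w'j ij]]] := edge_pos yw yw'.
have [q' [cq' jm _]] := w'j.
have := cdist_le_walk yw (proj1 (distP' w' x)) w'j xk.
have [yx wx'] := dist_at_pos yw xk.
have i0 : i = 0 by apply: at_pos_uniq yw yi _; exists q'; split=> //; lia.
have j1 : j <> 1.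
  move=> j1; apply: wNw'; case: w'j => q2 [_ _]; by rewrite j1.
move: ij yx wx' km jm; rewrite i0 /cyc_next /cdist.
by do 2 case: ltnP => ?; move=> []; lia.
Qed.

End Polygon.

(** * Projections *)

Section ProjectionDef.
Variables (V : choiceType) (G : typed_graph V).

Lemma pr_sig : {f : V -> V -> V | forall x y,
  (exists w, adj G x w /\ dist G w y < dist G x y) ->
  adj G x (f x y) /\ dist G (f x y) y < dist G x y}.
Proof.
exists (fun x y => xget x [set w | adj G x w /\ dist G w y < dist G x y]).
by move=> x y [w xw]; case: xgetP => [_ _ //|no]; case: (no w).
Qed.

(** Where the neighbour of x closest to y is unique, the chamber {x, pr x y} is the
    projection of y to the panel x. *)
Definition pr : V -> V -> V := sval pr_sig.

Lemma pr_closer x y : (exists w, adj G x w /\ dist G w y < dist G x y) ->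
  adj G x (pr x y) /\ dist G (pr x y) y < dist G x y.
Proof. exact: (svalP pr_sig). Qed.

End ProjectionDef.

Section Projection.
Variables (V : choiceType) (G : typed_graph V) (m : nat).
Hypothesis m_ge3 : 2 < m.
Hypothesis poly : polygon G m.

Notation d := (dist G).
Notation adj := (adj G).
Let conn := polygon_conn poly.

Notation pr := (pr G).

Lemma prP (x y : V) : 0 < d x y -> adj x (pr x y) /\ d x y = (d (pr x y) y).+1.
Proof.
move=> xy; have [|xp py] := @pr_closer _ G x y.
  by have [w xw wy] := dist_pred conn xy; exists w; split=> //; lia.
by split=> //; have := dist_step conn y xp; lia.
Qed.

Lemma pr_uniq (x y w : V) : d x y < m -> adj x w -> d w y < d x y -> pr x y = w.
Proof.
move=> xym xw wy; have [|xp py] := @prP x y; first exact: leq_ltn_trans wy.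
by apply: (closer_uniq m_ge3 poly xym xp xw) => //; lia.
Qed.

Lemma far_step (x y w : V) : 0 < d x y -> d x y < m -> adj x w -> w <> pr x y ->
  d w y = (d x y).+1.
Proof.
move=> xy xym xw wp; case: (dist_step conn y xw) => // wy.
by case: wp; rewrite (pr_uniq xym xw) //; lia.
Qed.

Lemma opp_adj (x y w : V) : d x y = m -> adj x w -> d w y = m.-1.
Proof.
by move=> xy xw; have := dist_step conn y xw; have := dist_le m_ge3 poly w y; lia.
Qed.

Lemma prM (x y : V) : d x y = m.-1 ->
  adj x (pr x y) /\ d (pr x y) y = m.-2.
Proof. by move=> xy; have [|? ?] := @prP x y; [lia|split=> //; lia]. Qed.

Lemma prM_uniq (x y w : V) : d x y = m.-1 -> adj x w -> d w y <= m.-2 ->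
  pr x y = w.
Proof. by move=> xy xw wy; apply: pr_uniq => //; lia. Qed.

Lemma far_opp (x y w w' : V) : d x y = m.-1 -> adj x w -> d w y <= m.-2 ->
  adj x w' -> w' <> w -> d w' y = m.
Proof.
move=> xy xw wy xw' ww'.
by rewrite (far_step (x := x)) ?(prM_uniq xy xw wy) ?xy; lia || done.
Qed.

(** Projections between opposite vertices are inverse bijections of panels. *)
Lemma persp (x y w : V) : d x y = m -> adj x w -> pr x (pr y w) = w.
Proof.
move=> xy xw; have yw : d y w = m.-1 by rewrite (distC conn); exact: opp_adj xw.
have [yp pw] := prM yw; apply: prM_uniq => //; last by rewrite (distC conn) pw.
by rewrite (distC conn); apply: (opp_adj (x := y)) => //; rewrite (distC conn).
Qed.

End Projection.

(** * Frames and the operations on a panel *)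

Section Frame.
Variables (V : choiceType) (G : typed_graph V) (m : nat).
Hypothesis m_ge3 : 2 < m.
Hypothesis poly : polygon G m.

Notation dist := (dist G).
Notation adj := (adj G).
Notation pr := (pr G).
Let conn := polygon_conn poly.
Let dC := distC conn.
Let opp_adj := opp_adj m_ge3 poly.
Let prM := prM m_ge3 poly.
Let prM_uniq := prM_uniq m_ge3 poly.
Let far_opp := far_opp m_ge3 poly.
Let persp := persp m_ge3 poly.
Let dist_step := dist_step conn.
Let tri := dist_triangle conn.

Let adjC (x y : V) : adj x y -> adj y x. Proof. by rewrite adj_sym. Qed.

(** A pair of opposite chambers {v, c} and {vo, co}, with v opposite vo and c
    opposite co, an element e of the panel of v and an element r of the panel of c
    that lie outside of the apartment.  The panel of v is treated like a
    coordinate line with c in the role of infinity and the other neighbour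
    d = pr v co of v in the apartment in the role of zero. *)
Record frame (W : Type) := Frame { fv : W; fc : W; fvo : W; fco : W; fe : W; fr : W }.

Definition frame_ok (k : frame V) : Prop :=
  [/\ [/\ adj (fv k) (fc k), adj (fvo k) (fco k), adj (fv k) (fe k) & adj (fc k) (fr k)],
      dist (fv k) (fvo k) = m, dist (fc k) (fco k) = m,
      fe k <> fc k /\ fe k <> pr (fv k) (fco k) &
      fr k <> fv k /\ fr k <> pr (fc k) (fvo k)].

(** Operations defined by iterated projections.  Automorphisms and limits commute
    with the projection of y to x when the distance of x and y is m - 1; terms
    allow to conclude once for all such operations, by induction. *)
Inductive term :=
  Tv | Tc | Tvo | Tco | Te | Tr | T1 | T2 | T3 | Pr of term & term.

Fixpoint ev (k : frame V) (x y z : V) (t : term) : V :=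
  match t with
  | Tv => fv k | Tc => fc k | Tvo => fvo k | Tco => fco k | Te => fe k | Tr => fr k
  | T1 => x | T2 => y | T3 => z
  | Pr s t => pr (ev k x y z s) (ev k x y z t)
  end.

Fixpoint wd (k : frame V) (x y z : V) (t : term) : Prop :=
  if t is Pr s u then
    [/\ wd k x y z s, wd k x y z u & dist (ev k x y z s) (ev k x y z u) = m.-1]
  else True.

Definition Td := Pr Tv Tco.
Definition Ts := Pr Tc Tvo.
Definition Tb := Pr Tvo Te.
(** om is opposite v and lies beyond r seen from c; e serves to transport r to a
    third element d1 of the panel of d, beyond which om lies seen from d. *)
Definition Tom := Pr Tb Tr.
(** q f depends continuously on f in the panel of v; it is a neighbour of co that
    is opposite v except for f = d, when it lies on the way from co to v. *)
Definition Tq (f : term) := Pr Tco (Pr f Tom).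
(** Multiplication by f: go from the panel of v to that of u with center p, where
    u is another neighbour of c, and come back with center q f.  The center p is
    the neighbour of co towards a third neighbour u' of c.  For f = d the second
    perspectivity degenerates to a constant. *)
Definition Tp (u' : term) := Pr Tco u'.
Definition Tmul (u u' f x : term) := Pr Tv (Pr (Tq f) (Pr u (Pr (Tp u') x))).
Definition Tdiv (u u' f x : term) := Pr Tv (Pr (Tp u') (Pr u (Pr (Tq f) x))).
(** Subtraction: t x is a center of the perspectivity from the panel of v to that
    of s which maps c to c and x to an element that does not depend on x; it is
    followed by the inverse of the same perspectivity for d. *)
Definition Tt (x : term) := Pr (Pr Tvo x) Tr.
Definition Tsub (x y : term) := Pr Tv (Pr (Tt Td) (Pr Ts (Pr (Tt x) y))).

Section Facts.
Variable k : frame V.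
Hypothesis kP : frame_ok k.
Notation v := (fv k).
Notation c := (fc k).
Notation vo := (fvo k).
Notation co := (fco k).
Notation e := (fe k).
Notation r := (fr k).
Let d := pr v co.
Let s := pr c vo.
Let b := pr vo e.
Let om := pr b r.
Let q f := pr co (pr f om).

Let vc : adj v c. Proof. by case: kP => -[]. Qed.
Let vco : adj vo co. Proof. by case: kP => -[]. Qed.
Let ve : adj v e. Proof. by case: kP => -[]. Qed.
Let cr : adj c r. Proof. by case: kP => -[]. Qed.
Let v_vo : dist v vo = m. Proof. by case: kP. Qed.
Let c_co : dist c co = m. Proof. by case: kP. Qed.
Let e_c : e <> c. Proof. by case: kP => _ _ _ []. Qed.
Let e_d : e <> d. Proof. by case: kP => _ _ _ []. Qed.
Let r_v : r <> v. Proof. by case: kP => _ _ _ _ []. Qed.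
Let r_s : r <> s. Proof. by case: kP => _ _ _ _ []. Qed.

Lemma v_co : dist v co = m.-1. Proof. exact: opp_adj c_co (adjC vc). Qed.
Lemma c_vo : dist c vo = m.-1. Proof. exact: opp_adj v_vo vc. Qed.
Lemma vd : adj v d. Proof. by case: (prM v_co). Qed.
Lemma d_co : dist d co = m.-2. Proof. by case: (prM v_co). Qed.
Lemma cs : adj c s. Proof. by case: (prM c_vo). Qed.
Lemma s_vo : dist s vo = m.-2. Proof. by case: (prM c_vo). Qed.
Lemma d_c : d <> c.
Proof. by move=> dc; have := d_co; rewrite dc c_co; lia. Qed.
Lemma s_v : s <> v.
Proof. by move=> sv; have := s_vo; rewrite sv v_vo; lia. Qed.

Lemma panel_vo (x : V) : adj v x -> dist vo x = m.-1.
Proof. by move=> vx; rewrite dC; apply: opp_adj vx. Qed.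

Lemma panel_co (x : V) : adj v x -> x <> d -> dist x co = m.
Proof.
by move=> vx xd; apply: (far_opp v_co vd) => //; rewrite d_co.
Qed.

Lemma panel_co_c (x : V) : adj c x -> dist co x = m.-1.
Proof. by move=> cx; rewrite dC; apply: opp_adj cx. Qed.

Lemma vo_b : adj vo b. Proof. by case: (prM (panel_vo ve)). Qed.
Lemma b_e : dist b e = m.-2. Proof. by case: (prM (panel_vo ve)). Qed.
Lemma v_b : dist v b = m.-1.
Proof. by rewrite dC; apply: (opp_adj (x := vo)) vo_b; rewrite dC. Qed.
Lemma b_opp (x : V) : adj v x -> x <> e -> dist b x = m.
Proof.
by move=> vx xe; rewrite dC; apply: (far_opp v_b ve) => //; rewrite dC b_e.
Qed.
Lemma b_c : dist b c = m. Proof. by apply: b_opp => // /esym. Qed.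
Lemma b_d : dist b d = m.
Proof. by apply: b_opp vd _ => /esym. Qed.
Lemma b_r : dist b r = m.-1. Proof. by rewrite dC; apply: opp_adj cr; rewrite dC b_c. Qed.
Lemma b_om : adj b om. Proof. by case: (prM b_r). Qed.
Lemma om_r : dist om r = m.-2. Proof. by case: (prM b_r). Qed.
Lemma c_om : dist c om = m.-1. Proof. by rewrite dC; apply: opp_adj b_c b_om. Qed.
Lemma om_v : dist v om = m.
Proof.
by apply: (far_opp c_om cr) => //; [rewrite dC om_r|exact: adjC|move=> /esym].
Qed.
Lemma panel_om (x : V) : adj v x -> dist x om = m.-1.
Proof. exact: opp_adj om_v. Qed.

Let d1 := pr d om.
Lemma d_d1 : adj d d1. Proof. by case: (prM (panel_om vd)). Qed.
Lemma d1_om : dist d1 om = m.-2. Proof. by case: (prM (panel_om vd)). Qed.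
Lemma d1_v : d1 <> v.
Proof. by move=> E; have := d1_om; rewrite E om_v; lia. Qed.

Lemma r_vo : dist r vo = m.
Proof. by apply: (far_opp c_vo cs) => //; rewrite s_vo. Qed.

(** If d1 pointed from d towards vo, then vo and om would both be the
    projection of d1 to b, but vo is opposite r and om is not. *)
Lemma d1_vo : ~ dist d1 vo <= m.-2.
Proof.
move=> d1vo; have bd1 : dist b d1 = m.-1.
  by rewrite dC; apply: opp_adj d_d1; rewrite dC b_d.
have p1 : pr b d1 = vo by apply: prM_uniq => //; [exact/adjC/vo_b|rewrite dC].
have p2 : pr b d1 = om by apply: prM_uniq => //; [exact: b_om|rewrite dC d1_om].
by have := om_r; rewrite -p2 p1 dC r_vo; lia.
Qed.

(** Since co is next to vo, a path from d1 to co of length m - 3 would show that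
    d1 points from d towards vo. *)
Lemma d1_co : dist d1 co = m.-1.
Proof.
have := dist_step co d_d1; rewrite d_co => -[-> |d1co]; first lia.
by case: d1_vo; have := tri co d1 vo; rewrite (dist1 conn (adjC vco)); lia.
Qed.

Lemma panel_y (f : V) : adj v f -> dist co (pr f om) = m.-1.
Proof.
move=> vf; rewrite dC; have [->|/eqP fd] := eqVneq f d; first exact: d1_co.
have [fy _] := prM (panel_om vf).
exact: opp_adj (panel_co vf fd) fy.
Qed.

Lemma co_q (f : V) : adj v f -> adj co (q f).
Proof. by move=> vf; case: (prM (panel_y vf)). Qed.

Lemma qdE : dist (q d) d = m.-2.-1 /\ dist (q d) v = m.-2.
Proof.
have co_d : 0 < dist co d by rewrite dC d_co; lia.
have [cow wd] := prP m_ge3 poly co_d; set w := pr co d in cow wd.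
rewrite dC d_co in wd.
have -> : q d = w.
  apply: prM_uniq => //; first exact: panel_y vd.
  by rewrite -/d1; have := tri d w d1; rewrite (dist1 conn d_d1); lia.
split; first lia.
have := tri d w v; rewrite (dist1 conn (adjC vd)).
by have := dist_step v cow; rewrite [dist co v]dC v_co; lia.
Qed.

(** If q f were not opposite v, it would be equal to q d, and both v and the
    neighbour of f towards om would be the projection of q d to f; but om is
    opposite v. *)
Lemma q_v (f : V) : adj v f -> f <> d -> dist (q f) v = m.
Proof.
move=> vf fd; have [qd qv] := qdE.
have cov : dist co v = m.-1 by rewrite dC v_co.
apply: (far_opp cov (co_q vd)) (co_q vf) _ => [|qq]; first by rewrite qv.
have [_ qy] := prM (panel_y vf); rewrite -/(q f) qq in qy.
have fq : dist f (q d) = m.-1.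
  rewrite (far_step m_ge3 poly (x := v)) ?[dist v _]dC ?qv //; try lia.
  by rewrite (pr_uniq m_ge3 poly (w := d)) ?[dist v _]dC ?qv //;
     [lia|exact: vd|rewrite dC qd; lia].
have [fy yom] := prM (panel_om vf).
have p1 : pr f (q d) = pr f om by apply: prM_uniq => //; rewrite dC qy.
have p2 : pr f (q d) = v by apply: prM_uniq => //; [exact: adjC|rewrite dC qv].
by move: yom; rewrite -p1 p2 om_v; lia.
Qed.

Lemma qd_u (u : V) : adj c u -> u <> v -> dist (q d) u = m.
Proof.
move=> cu uv; have [qd qv] := qdE.
have cq : dist c (q d) = m.-1.
  rewrite (far_step m_ge3 poly (x := v)) ?[dist v _]dC ?qv //; try lia.
  by rewrite (pr_uniq m_ge3 poly (w := d)) ?[dist v _]dC ?qv //;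
     [move=> /esym/d_c|lia|exact: vd|rewrite dC qd; lia].
rewrite dC; apply: (far_opp cq (adjC vc)) => //.
by rewrite dC qv.
Qed.

Lemma q_c (f : V) : adj v f -> dist c (q f) = m.-1.
Proof. by move=> vf; rewrite dC; apply: opp_adj (co_q vf); rewrite dC. Qed.

Let panel_opp (x y w : V) : dist x y = m -> adj y w -> dist x w = m.-1.
Proof. by move=> xy yw; rewrite dC; apply: opp_adj yw; rewrite dC. Qed.

Let pr_adj (x y w : V) : dist x y = m -> adj y w -> adj x (pr x w).
Proof. by move=> xy yw; case: (prM (panel_opp xy yw)). Qed.

Let panel_opp' (x y w : V) : dist x y = m -> adj x w -> dist y w = m.-1.
Proof. by rewrite dC; exact: panel_opp. Qed.

Let pr_adj' (x y w : V) : dist x y = m -> adj x w -> adj y (pr y w).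
Proof. by rewrite dC; exact: pr_adj. Qed.

Section Scale.
Variables u u' : V.
Hypotheses (cu : adj c u) (cu' : adj c u') (uv : u <> v) (u'v : u' <> v) (uu' : u <> u').
Let p := pr co u'.

Lemma co_p : adj co p. Proof. by case: (prM (panel_co_c cu')). Qed.

Lemma p_opp (x : V) : adj c x -> x <> u' -> dist p x = m.
Proof.
move=> cx xu'; have [cop pu'] := prM (panel_co_c cu').
have cp : dist c p = m.-1 by rewrite dC; apply: opp_adj cop; rewrite dC.
by rewrite dC; apply: (far_opp cp cu') => //; rewrite dC pu'.
Qed.

Lemma p_v : dist p v = m. Proof. by apply: p_opp; [exact: adjC|move=> /esym]. Qed.
Lemma p_u : dist p u = m. Proof. exact: p_opp. Qed.

(** The degenerate case of the multiplication: q d is at distance m - 2 from v with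
    d on the way, so that all neighbours of q d but one are projected to d, and
    the exception corresponds to x = c. *)
Lemma mul_d (x : V) : adj v x -> x <> c ->
  [/\ dist p x = m.-1, dist u (pr p x) = m.-1,
      dist (q d) (pr u (pr p x)) = m.-1,
      dist v (pr (q d) (pr u (pr p x))) = m.-1 &
      pr v (pr (q d) (pr u (pr p x))) = d].
Proof.
move=> vx xc; have px := panel_opp p_v vx; have pj := pr_adj p_v vx.
have uj := panel_opp' p_u pj; have uX := pr_adj' p_u pj.
set j := pr p x in pj uj uX *; set X := pr u j in uX *.
have X_c : X <> c.
  move=> Xc; apply: xc; have <- : pr v j = x by apply: persp; rewrite 1?dC ?p_v.
  apply: prM_uniq => //; first exact: panel_opp' p_v pj.
  by have [_] := prM uj; rewrite -/X Xc => ->.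
have qu := qd_u cu uv; have qX := panel_opp qu uX; have qj := pr_adj qu uX.
set y := pr (q d) X in qj *; have [_ Xy] := prM qX; rewrite -/y dC in Xy.
have cy : dist c y = m.
  exact: (far_opp (panel_opp' qu qj) uX (eq_leq Xy) (adjC cu) (nesym X_c)).
have vy : dist v y = m.-1 by exact: opp_adj cy (adjC vc).
have [qd _] := qdE.
have dy : dist d y <= m.-2.
  have qdd : dist d (q d) = m.-2.-1 by rewrite dC.
  have h1 := tri (q d) d y.
  have h2 := dist1 conn qj.
  rewrite h2 qdd in h1.
  by apply: leq_trans h1 _; clear -m_ge3; lia.
by split=> //; apply: prM_uniq vy vd dy.
Qed.

Section Regular.
Variable f : V.
Hypotheses (vf : adj v f) (qv : dist (q f) v = m) (qu : dist (q f) u = m).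

Lemma div_dist (x : V) : adj v x ->
  [/\ dist (q f) x = m.-1, dist u (pr (q f) x) = m.-1,
      dist p (pr u (pr (q f) x)) = m.-1,
      dist v (pr p (pr u (pr (q f) x))) = m.-1 &
      adj v (pr v (pr p (pr u (pr (q f) x))))].
Proof.
move=> vx; have j1 := pr_adj qv vx; have j2 := pr_adj' qu j1.
have j3 := pr_adj p_u j2; have j4 := pr_adj' p_v j3.
have := panel_opp qv vx; have := panel_opp' qu j1.
by have := panel_opp p_u j2; have := panel_opp' p_v j3; split.
Qed.

Lemma mul_div (x : V) : adj v x ->
  pr v (pr (q f) (pr u (pr p (pr v (pr p (pr u (pr (q f) x))))))) = x.
Proof.
move=> vx; have j1 := pr_adj qv vx; have j2 := pr_adj' qu j1.
have j3 := pr_adj p_u j2.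
rewrite (persp (x := p) (y := v)) ?p_v // (persp (x := u) (y := p)) 1?dC ?p_u //.
by rewrite (persp (x := q f)) // (persp (x := v) (y := q f)) // dC.
Qed.

(** Seen from q f as well as from p, the vertex d lies beyond co. *)
Lemma div_d : pr v (pr p (pr u (pr (q f) d))) = d.
Proof.
have -> : pr (q f) d = co.
  by apply: prM_uniq (panel_opp qv vd) (adjC (co_q vf)) _; rewrite dC d_co.
by rewrite (persp p_u (adjC co_p)).
Qed.

End Regular.
End Scale.

Section Translation.
Let kk x := pr vo x.
Let t x := pr (kk x) r.

Lemma kkP (x : V) : adj v x -> x <> c ->
  [/\ adj vo (kk x), dist (kk x) x = m.-2, dist (kk x) c = m & dist (kk x) r = m.-1].
Proof.
move=> vx xc; have [vok kx] := prM (panel_vo vx); rewrite -/(kk x) in vok kx.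
have vk : dist v (kk x) = m.-1.
  by rewrite dC; apply: (opp_adj (x := vo)) => //; rewrite dC.
have kc : dist (kk x) c = m.
  rewrite dC; apply: (far_opp vk vx) => //; last exact: nesym.
  by rewrite dC kx.
by split=> //; rewrite dC; apply: opp_adj cr; rewrite dC.
Qed.

Lemma tP (x : V) : adj v x -> x <> c ->
  [/\ adj (kk x) (t x), dist (t x) v = m & dist (t x) s = m].
Proof.
move=> vx xc; have [vok kx kc kr] := kkP vx xc.
have [kt tr] := prM kr; rewrite -/(t x) in kt tr.
have ct : dist c (t x) = m.-1 by rewrite dC; apply: opp_adj kt.
by split=> //; rewrite dC; apply: (far_opp ct cr); rewrite 1?dC ?tr //;
  [exact: adjC|exact: nesym|exact: cs|exact: nesym].
Qed.

(** The translation with center t x sends x to the vertex next to s on the path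
    from s to vo, whatever x is. *)
Lemma translation_zero (x : V) : adj v x -> x <> c ->
  pr s (pr (t x) x) = pr s vo.
Proof.
move=> vx xc; have [vok kx kc kr] := kkP vx xc; have [kt tv ts] := tP vx xc.
have -> : pr (t x) x = kk x.
  apply: prM_uniq; [exact: panel_opp tv vx|exact: adjC|by rewrite kx].
have [|sy y_vo] := prP m_ge3 poly (x := s) (y := vo); first by rewrite s_vo; lia.
rewrite s_vo in y_vo; apply: prM_uniq => //.
  by apply: opp_adj cs; rewrite dC.
by have := tri vo (pr s vo) (kk x); rewrite (dist1 conn vok); lia.
Qed.

Lemma sub_dist (x y : V) : adj v x -> x <> c -> adj v y ->
  [/\ dist (t x) y = m.-1, dist s (pr (t x) y) = m.-1,
      dist (t d) (pr s (pr (t x) y)) = m.-1,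
      dist v (pr (t d) (pr s (pr (t x) y))) = m.-1 &
      adj v (pr v (pr (t d) (pr s (pr (t x) y))))].
Proof.
move=> vx xc vy; have [_ tv ts] := tP vx xc; have [_ dv ds] := tP vd d_c.
have j1 := pr_adj tv vy; have j2 := pr_adj' ts j1.
have j3 := pr_adj ds j2; have j4 := pr_adj' dv j3.
have := panel_opp tv vy; have := panel_opp' ts j1.
by have := panel_opp ds j2; have := panel_opp' dv j3; split.
Qed.

Lemma sub_diag (x : V) : adj v x -> x <> c ->
  pr v (pr (t d) (pr s (pr (t x) x))) = d.
Proof.
move=> vx xc; rewrite translation_zero // -(translation_zero vd d_c).
have [_ dv ds] := tP vd d_c; have j1 := pr_adj dv vd.
by rewrite (persp (x := t d) (y := s)) // (persp (x := v) (y := t d)) ?vd // dC.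
Qed.

Lemma sub_eq (x y : V) : adj v x -> x <> c -> adj v y ->
  pr v (pr (t d) (pr s (pr (t x) y))) = d -> y = x.
Proof.
move=> vx xc vy E; have [_ tv ts] := tP vx xc; have [_ dv ds] := tP vd d_c.
have j1 := pr_adj tv vy; have j2 := pr_adj' ts j1.
have j3 := pr_adj ds j2.
have vt : dist v (t x) = m by rewrite dC.
have E2 : pr s (pr (t x) y) = pr s (pr (t x) x).
  have W : pr (t d) (pr s (pr (t x) y)) = pr (t d) d.
    by rewrite -(persp dv j3) E.
  have sd : dist s (t d) = m by rewrite dC.
  by rewrite (translation_zero vx xc) -(translation_zero vd d_c) -W (persp sd j2).
have j1x := pr_adj tv vx.
have E3 : pr (t x) y = pr (t x) x.
  by rewrite -(persp ts j1) -[RHS](persp ts j1x) E2.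
by rewrite -(persp vt vy) E3 (persp vt vx).
Qed.

End Translation.

(** Exchanging zero and infinity requires a third element of the panel of d, for
    which d1 is available. *)
Definition swap_frame : frame V := Frame v d vo (pr vo c) e d1.

Lemma swap_frame_ok :
  frame_ok swap_frame /\ pr (fv swap_frame) (fco swap_frame) = c.
Proof.
have [vop pc] := prM (panel_vo vc).
have vp : dist v (pr vo c) = m.-1.
  by rewrite dC; apply: (opp_adj (x := vo)) => //; rewrite dC.
have vE : pr v (pr vo c) = c by apply: prM_uniq => //; rewrite dC pc.
split=> //; split=> /=; rewrite ?vE //.
- by split=> //; [exact: vd|exact: d_d1].
- by apply: far_opp vp vc _ vd d_c; rewrite dC pc.
- split; first exact: d1_v.
  move=> d1E; apply: d1_vo; rewrite d1E.
  by case: (prM (opp_adj v_vo vd)) => _ ->.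
Qed.

Definition flip_frame : frame V := Frame c v co vo r e.

End Facts.
End Frame.

(** * Limits along ultrafilters *)

(** Compact polygons, with the metric weakened to the Hausdorff property and
    thickness expressed by neighbours. *)
Record compact_building (V : topologicalType) (G : typed_graph V) (m : nat) :
    Prop := CompactBuilding {
  cb_m : 2 < m;
  cb_polygon : polygon G m;
  cb_compact : compact [set: V];
  cb_hausdorff : hausdorff_space V;
  cb_closed : closed (chamber_set G);
  cb_thick : forall x a b : V, exists w, [/\ adj G x w, w <> a & w <> b]
}.

Lemma ultra_fmap (I T : Type) (U : set_system I) (f : I -> T) :
  UltraFilter U -> UltraFilter (f @ U).
Proof.
move=> UU; split; first exact: fmap_proper_filter.
move=> H HH UH; rewrite predeqE => A; split=> [HA|]; last exact: UH.
have [//|nA] := in_ultra_setVsetC (f @^-1` A) UU.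
have HnA : H (~` A) by apply: UH.
have : H (A `&` ~` A) by exact: filterI.
by rewrite setICr => /filter_not_empty.
Qed.

Lemma ultra_bounded (I : Type) (U : set_system I) (f : I -> nat) n :
  UltraFilter U -> (\forall i \near U, f i <= n) ->
  exists2 k, k <= n & \forall i \near U, f i = k.
Proof.
move=> UU; elim: n => [|n IH] fn.
  by exists 0 => //; apply: filterS fn => i; rewrite leqn0 => /eqP.
have [fE|fN] := in_ultra_setVsetC [set i | f i = n.+1] UU.
  by exists n.+1.
have [|k kn fk] := IH.
  by apply: filterS2 fn fN => i /= fin /eqP fiN; lia.
by exists k => //; exact: leqW.
Qed.

Lemma near_const (I : Type) (U : set_system I) (P : Prop) :
  UltraFilter U -> (\forall i \near U, P) -> P.
Proof. by move=> UU /filter_ex[]. Qed.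

Section UltraLimit.
Variables (V : topologicalType) (G : typed_graph V) (m : nat).
Hypothesis H : compact_building G m.

Notation dist := (dist G).
Notation adj := (adj G).
Notation pr := (pr G).
Let m_ge3 := cb_m H.
Let poly := cb_polygon H.
Let conn := polygon_conn poly.

Section OneFilter.
Variables (I : Type) (U : set_system I).
Hypothesis UU : UltraFilter U.

Lemma ultra_cvg (x : I -> V) : exists l : V, x @ U --> l.
Proof.
have := cb_compact H; rewrite compact_ultra => /(_ (x @ U) (ultra_fmap x UU)).
by case=> [|l [_ xl]]; [exact: filterT|exists l].
Qed.

Definition ulim (x : I -> V) : V := sval (cid (ultra_cvg x)).
Notation lm := ulim.

Lemma lm_cvg (x : I -> V) : x @ U --> lm x.
Proof. by rewrite /ulim; case: cid. Qed.

Lemma lm_eq (x : I -> V) (l : V) : x @ U --> l -> lm x = l.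
Proof.
move=> xl; apply: (@cvg_unique V (cb_hausdorff H) (x @ U)) => //.
exact: lm_cvg.
Qed.

Lemma lm_cst (l : V) : lm (fun=> l) = l.
Proof. by apply: lm_eq; exact: cvg_cst. Qed.

Lemma lm_near (x y : I -> V) : (\forall i \near U, x i = y i) -> lm x = lm y.
Proof.
move=> xy; apply: lm_eq => A /lm_cvg yA.
by apply: filterS2 xy yA => i /= ->.
Qed.

Lemma lm_nbhs (x : I -> V) (A : set V) :
  nbhs (lm x) A -> \forall i \near U, A (x i).
Proof. exact: lm_cvg. Qed.

Lemma lm_closed (x : I -> V) (A : set V) : closed A ->
  (\forall i \near U, A (x i)) -> A (lm x).
Proof. by move=> cA Ax; apply: (closed_cvg A cA Ax); exact: lm_cvg. Qed.

Lemma lm_neq (x y : I -> V) : lm x <> lm y -> \forall i \near U, x i <> y i.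
Proof.
move=> xy; have [E|//] := in_ultra_setVsetC [set i | x i = y i] UU.
by case: xy; exact: lm_near.
Qed.

Lemma lm_chamber (x y : I -> V) :
  (\forall i \near U, chamber_set G (x i, y i)) -> chamber_set G (lm x, lm y).
Proof.
move=> xy; apply: (closed_cvg _ (cb_closed H) xy).
by apply: cvg_pair; exact: lm_cvg.
Qed.

Lemma lm_adj_ty (x y : I -> V) b :
  (\forall i \near U, adj (x i) (y i) /\ ty G (x i) = b) ->
  adj (lm x) (lm y) /\ ty G (lm x) = b.
Proof.
move=> xy; have tyy i : adj (x i) (y i) -> ty G (y i) = ~~ ty G (x i).
  by move=> /adj_ty; case: (ty _ (x i)); case: (ty _ (y i)).
case: b xy => xy.
  have [|? ? ?] := @lm_chamber y x.
    by apply: filterS xy => i [a t]; split; rewrite //= ?tyy ?t // adj_sym.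
  by rewrite adj_sym.
have [|? ? ?] := @lm_chamber x y.
  by apply: filterS xy => i [a t]; split; rewrite //= ?tyy ?t.
by [].
Qed.

Lemma lm_adj (x y : I -> V) :
  (\forall i \near U, adj (x i) (y i)) -> adj (lm x) (lm y).
Proof.
move=> xy; have [t|t] := in_ultra_setVsetC [set i | ty G (x i) = true] UU.
  by have [] := @lm_adj_ty x y true; first exact: filterS2 xy t.
have [] // := @lm_adj_ty x y false; apply: filterS2 xy t => i ? /= /eqP.
by rewrite eqb_id => /negPf.
Qed.

(** A type is carried to the limit together with an edge, as chambers are ordered
    by type. *)
Lemma lm_ty (x : I -> V) : \forall i \near U, ty G (x i) = ty G (lm x).
Proof.
have /choice[y xy] : forall i, exists y, adj (x i) y.
  by move=> i; exact: polygon_edge poly _.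
have [t|t] := in_ultra_setVsetC [set i | ty G (x i) = true] UU.
  have [|_ ->] := @lm_adj_ty x y true; last exact: t.
  by apply: filterS t.
have {}t : \forall i \near U, ty G (x i) = false.
  by apply: filterS t => i /= /eqP; rewrite eqb_id => /negPf.
have [|_ ->] := @lm_adj_ty x y false; last exact: t.
by apply: filterS t.
Qed.

Lemma lm_walk n (x y : I -> V) :
  (\forall i \near U, walk G n (x i) (y i)) -> walk G n (lm x) (lm y).
Proof.
elim: n y => [|n IH] y xy /=; first exact: lm_near.
have /choice[z xzy] : forall i, exists z, walk G n.+1 (x i) (y i) ->
    walk G n (x i) z /\ adj z (y i).
  move=> i; have [[z ? ?]|no] := pselect (walk G n.+1 (x i) (y i)).
    by exists z.
  by exists (x i).
exists (lm z); first by apply: IH; apply: filterS xy => i /xzy[].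
by apply: lm_adj; apply: filterS xy => i /xzy[].
Qed.

Lemma lm_dist_le n (x y : I -> V) :
  (\forall i \near U, dist (x i) (y i) <= n) -> dist (lm x) (lm y) <= n.
Proof.
move=> /(ultra_bounded UU)[k kn xy]; apply: leq_trans kn.
apply: dist_walk => //; apply: lm_walk; apply: filterS xy => i <-.
by case: (distP conn (x i) (y i)).
Qed.

(** Distances are lower semicontinuous, and by parity they are locally constant
    where they differ by at most one from the diameter. *)
Lemma lm_dist (x y : I -> V) : m.-1 <= dist (lm x) (lm y) ->
  \forall i \near U, dist (x i) (y i) = dist (lm x) (lm y).
Proof.
move=> xym; have [|k km xy] := @ultra_bounded I U (fun i => dist (x i) (y i)) m UU.
  by apply: nearW => i; exact: dist_le.
suff <- : k = dist (lm x) (lm y) by [].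
have le_k : dist (lm x) (lm y) <= k.
  by apply: lm_dist_le; apply: filterS xy => i ->.
have : odd k = odd (dist (lm x) (lm y)).
  apply: (@near_const _ U) => //; apply: filterS3 xy (lm_ty x) (lm_ty y).
  move=> i <- tx tY; have := dist_ty conn (x i) (y i).
  by rewrite tx tY dist_ty // => /negb_inj ->.
have := dist_le m_ge3 poly (lm x) (lm y); lia.
Qed.

Lemma lm_distE n (x y : I -> V) : m.-1 <= n -> dist (lm x) (lm y) = n ->
  \forall i \near U, dist (x i) (y i) = n.
Proof. by move=> + E; rewrite -E; exact: lm_dist. Qed.

(** The limit of the projections of y to x is a neighbour of lm x at distance at
    most m - 2 from lm y, and there is only one. *)
Lemma lm_pr (x y : I -> V) : dist (lm x) (lm y) = m.-1 ->
  lm (fun i => pr (x i) (y i)) = pr (lm x) (lm y).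
Proof.
move=> xym; have xy := lm_dist (eq_leq (esym xym)); rewrite xym in xy.
apply: esym; apply: (prM_uniq m_ge3 poly xym).
  by apply: lm_adj; apply: filterS xy => i /(prM m_ge3 poly)[].
by apply: lm_dist_le; apply: filterS xy => i /(prM m_ge3 poly)[_ ->].
Qed.

Definition ulim_frame (k : I -> frame V) : frame V :=
  Frame (lm (fun i => fv (k i))) (lm (fun i => fc (k i)))
    (lm (fun i => fvo (k i))) (lm (fun i => fco (k i)))
    (lm (fun i => fe (k i))) (lm (fun i => fr (k i))).
Notation lmF := ulim_frame.

Lemma ev_lm (k : I -> frame V) (x y z : I -> V) t :
  wd G m (lmF k) (lm x) (lm y) (lm z) t ->
  lm (fun i => ev G (k i) (x i) (y i) (z i) t) =
  ev G (lmF k) (lm x) (lm y) (lm z) t.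
Proof.
elim: t => //= s IHs t IHt [/IHs ws /IHt wt st].
by rewrite lm_pr ws wt.
Qed.

End OneFilter.
End UltraLimit.

(** * Automorphisms *)

Section Automorphism.
Variables (V : choiceType) (G : typed_graph V) (m : nat).
Hypothesis m_ge3 : 2 < m.
Hypothesis poly : polygon G m.
Let conn := polygon_conn poly.

Definition map_frame (f : V -> V) (k : frame V) : frame V :=
  Frame (f (fv k)) (f (fc k)) (f (fvo k)) (f (fco k)) (f (fe k)) (f (fr k)).

Lemma walk_aut (f : V -> V) n (x y : V) :
  (forall a b, adj G (f a) (f b) = adj G a b) ->
  walk G n x y -> walk G n (f x) (f y).
Proof.
move=> fa; elim: n y => [y ->//|n IH y [z xz zy]].
by exists (f z); [exact: IH|rewrite fa].
Qed.

Variable f : V -> V.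
Hypothesis f_aut : is_automorphism G f.

Lemma dist_aut (x y : V) : dist G (f x) (f y) = dist G x y.
Proof.
have [[g fK gK] fa] := f_aut.
have ga a b : adj G (g a) (g b) = adj G a b by rewrite -fa !gK.
apply/eqP; rewrite eqn_leq; apply/andP; split.
  by apply: dist_walk => //; apply: walk_aut => //; case: (distP conn x y).
rewrite -{1}(fK x) -{1}(fK y).
by apply: dist_walk => //; apply: walk_aut => //; case: (distP conn (f x) (f y)).
Qed.

Lemma pr_aut (x y : V) : dist G x y = m.-1 -> f (pr G x y) = pr G (f x) (f y).
Proof.
move=> xy; have [xp py] := prM m_ge3 poly xy; apply: esym.
apply: (prM_uniq m_ge3 poly); rewrite ?dist_aut ?py //.
by have [_ ->] := f_aut.
Qed.

Lemma ev_aut (k : frame V) (x y z : V) t : wd G m k x y z t ->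
  f (ev G k x y z t) = ev G (map_frame f k) (f x) (f y) (f z) t.
Proof. by elim: t => //= s IHs t IHt [/IHs <- /IHt <- /pr_aut]. Qed.

Lemma aut_inj : injective f.
Proof. by have [/bij_inj] := f_aut. Qed.

Lemma frame_ok_aut (k : frame V) : frame_ok G m k -> frame_ok G m (map_frame f k).
Proof.
have [_ fa] := f_aut; have fI := aut_inj.
move=> kP; have [[a1 a2 a3 a4] d1 d2 [e1 e2] [r1 r2]] := kP.
have v_co' := v_co m_ge3 poly kP; have c_vo' := c_vo m_ge3 poly kP.
split; rewrite /= ?fa ?dist_aut -?pr_aut //.
  by split=> /fI.
by split=> /fI.
Qed.

End Automorphism.

(** * The operations are defined *)

Section WellDefined.
Variables (V : choiceType) (G : typed_graph V) (m : nat).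
Hypothesis m_ge3 : 2 < m.
Hypothesis poly : polygon G m.
Variable k : frame V.
Hypothesis kP : frame_ok G m k.
Variables x y z : V.

Notation dist := (dist G).
Notation adj := (adj G).
Notation v := (fv k).
Notation c := (fc k).
Notation "[| t |]" := (ev G k x y z t).
Notation wd := (wd G m k x y z).

(* The two choices for the auxiliary vertices u and u'. *)
Definition Tu (b : bool) := if b then Ts else Tr.

Lemma TuP (b : bool) : [/\ wd (Tu b), adj c [|Tu b|], [|Tu b|] <> v &
  [|Tu b|] <> [|Tu (~~ b)|]].
Proof.
have [[_ _ _ cr] _ _ _ [rv rs]] := kP.
have := c_vo m_ge3 poly kP; have := cs m_ge3 poly kP.
by have := s_v m_ge3 poly kP; case: b => //= *; split=> //; exact: nesym.
Qed.

Lemma wd_d : wd Td.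
Proof. by split=> //=; exact: v_co kP. Qed.

Lemma wd_om : wd Tom.
Proof.
have [[_ _ ve _] _ _ _ _] := kP.
by split=> //=; [split=> //; exact: (panel_vo m_ge3 poly kP ve)|exact: b_r kP].
Qed.

Lemma wd_q t : wd t -> adj v [|t|] -> wd (Tq t).
Proof.
move=> wt vt; split=> //=; last exact: panel_y kP _ vt.
by split=> //; [exact: wd_om|exact: panel_om kP _ vt].
Qed.

Lemma wd_p b : wd (Tp (Tu b)).
Proof.
by have [wu cu _ _] := TuP b; split=> //=; exact: panel_co_c kP _ cu.
Qed.

Lemma wd_div b f t : wd f -> adj v [|f|] -> wd t -> adj v [|t|] ->
  dist [|Tq f|] v = m -> dist [|Tq f|] [|Tu b|] = m ->
  wd (Tdiv (Tu b) (Tu (~~ b)) f t) /\ adj v [|Tdiv (Tu b) (Tu (~~ b)) f t|].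
Proof.
move=> wf vf wt vt qv qu; have [wu cu uv uu'] := TuP b.
have [wu' cu' u'v _] := TuP (~~ b).
have [d1 d2 d3 d4 a] := div_dist m_ge3 poly kP cu cu' u'v uu' qv qu vt.
split=> //; have wq := wd_q wf vf; have wp := wd_p (~~ b).
do 3 (split=> //).
Qed.

Lemma ev_mul_div b f t : adj v [|f|] -> adj v [|t|] ->
  dist [|Tq f|] v = m -> dist [|Tq f|] [|Tu b|] = m ->
  [|Tmul (Tu b) (Tu (~~ b)) f (Tdiv (Tu b) (Tu (~~ b)) f t)|] = [|t|].
Proof.
move=> vf vt qv qu; have [_ cu uv uu'] := TuP b.
have [_ cu' u'v _] := TuP (~~ b).
by have := mul_div m_ge3 poly kP cu cu' u'v uu' qv qu vt.
Qed.

Lemma ev_div_d b f t : adj v [|f|] -> [|t|] = [|Td|] -> dist [|Tq f|] v = m ->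
  [|Tdiv (Tu b) (Tu (~~ b)) f t|] = [|Td|].
Proof.
move=> vf td qv; have [_ cu _ uu'] := TuP b.
have [_ cu' _ _] := TuP (~~ b); rewrite /= td.
by have := div_d m_ge3 poly kP cu cu' uu' vf qv.
Qed.

Lemma wd_mul_d b f t : wd f -> [|f|] = [|Td|] -> wd t -> adj v [|t|] -> [|t|] <> c ->
  wd (Tmul (Tu b) (Tu (~~ b)) f t) /\ [|Tmul (Tu b) (Tu (~~ b)) f t|] = [|Td|].
Proof.
move=> wf fd wt vt tc; have [wu cu uv uu'] := TuP b.
have [wu' cu' u'v _] := TuP (~~ b).
have [d1 d2 d3 d4 E] := mul_d m_ge3 poly kP cu cu' uv u'v uu' vt tc.
have wq : wd (Tq f) by apply: wd_q => //; rewrite fd; exact: vd kP.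
have wp := wd_p (~~ b).
move: wq wp; rewrite /= fd => wq wp; split=> //; do 3 (split=> //).
Qed.

Lemma wd_t t : wd t -> adj v [|t|] -> [|t|] <> c -> wd (Tt t).
Proof.
move=> wt vt tc; have [_ _ _ kr] := kkP m_ge3 poly kP vt tc.
by split=> //=; split=> //; exact: panel_vo kP _ vt.
Qed.

Lemma wd_sub s t : wd s -> adj v [|s|] -> [|s|] <> c -> wd t -> adj v [|t|] ->
  wd (Tsub s t) /\ adj v [|Tsub s t|].
Proof.
move=> ws vs sc wt vt.
have [d1 d2 d3 d4 a] := sub_dist m_ge3 poly kP vs sc vt.
have wT := wd_t ws vs sc.
have wTd : wd (Tt Td) by apply: wd_t; [exact: wd_d|exact: vd kP|exact: d_c kP].
have [wS _ _ _] := TuP true.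
by split=> //; do 3 (split=> //).
Qed.

End WellDefined.

(** * Limits of automorphisms on a panel *)

Section Panel.
Variables (V : topologicalType) (G : typed_graph V) (m : nat).
Hypothesis H : compact_building G m.

Notation dist := (dist G).
Notation adj := (adj G).
Notation pr := (pr G).
Let m_ge3 := cb_m H.
Let poly := cb_polygon H.
Let conn := polygon_conn poly.
Let dC := distC conn.

(** By thickness, a vertex that is not opposite x has a neighbour further away
    from x. *)
Lemma opp_exists (x : V) : exists y, dist x y = m.
Proof.
suff far n : n <= m -> exists y, n <= dist x y.
  have [y my] := far m (leqnn m); exists y; apply/eqP.
  by rewrite eqn_leq my dist_le.
elim: n => [|n IH] nm; first by exists x.
have [y ny] := IH (ltnW nm); have [ny1|ny1] := ltnP n (dist x y); first by exists y.
have yx : dist y x = n by rewrite dC; apply/eqP; rewrite eqn_leq ny ny1.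
have [w [yw wp _]] := cb_thick H y (pr y x) y.
exists w; rewrite dC; case: (dist_step conn x yw) => [->|wx]; first by rewrite yx.
by case: wp; rewrite (pr_uniq m_ge3 poly _ yw) //; rewrite ?yx // -yx wx.
Qed.

Section OneFilter.
Variables (I : Type) (U : set_system I).
Hypothesis UU : UltraFilter U.
Notation lm := (ulim H UU).
Notation lmF := (ulim_frame H UU).

(** The perspectivities from a fixed panel opposite to the limit of v provide the
    elements. *)
Lemma panel_lift (v : I -> V) (P : V) : adj (lm v) P ->
  exists X : I -> V, lm X = P /\ \forall i \near U, adj (v i) (X i).
Proof.
move=> vP; have [w vw] := opp_exists (lm v).
have wP : dist w P = m.-1.
  by rewrite dC; apply: (opp_adj m_ge3 poly) vP.
have [wj jP] := prM m_ge3 poly wP.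
have vj : dist (lm v) (pr w P) = m.-1.
  by rewrite dC; apply: (opp_adj m_ge3 poly) wj; rewrite dC.
exists (fun i => pr (v i) (pr w P)); split.
  by rewrite lm_pr lm_cst // (persp m_ge3 poly vw vP).
have : \forall i \near U, dist (v i) (pr w P) = m.-1.
  by apply: (lm_distE (H := H) (UU := UU) (y := fun=> pr w P)) => //; rewrite lm_cst.
by apply: filterS => i /(prM m_ge3 poly)[].
Qed.

Definition map_net (phi : I -> V -> V) (k : I -> frame V) : I -> frame V :=
  fun i => map_frame (phi i) (k i).

(** The zero of the panel of the frame. *)
Definition third (k : frame V) : V := pr (fv k) (fco k).

(** What remains of the metric conditions: nothing close to zero is mapped close to
    the image of infinity, and nothing close to infinity close to the image of
    zero.  In this form they are symmetric in zero and infinity, invariant under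
    inversion of phi, and apply to frames that vary with the index. *)
Definition separated (phi : I -> V -> V) (k : I -> frame V) : Prop :=
  exists Sc Sd Tc Td : set V,
  [/\ nbhs (fc (lmF k)) Sc /\ nbhs (third (lmF k)) Sd,
      nbhs (fc (lmF (map_net phi k))) Tc /\ nbhs (third (lmF (map_net phi k))) Td &
      \forall i \near U, forall X, adj (fv (k i)) X ->
        ~ (Sd X /\ Tc (phi i X)) /\ ~ (Sc X /\ Td (phi i X))].

Record linked (phi : I -> V -> V) (k : I -> frame V) : Prop := Linked {
  lk_aut : forall i, is_automorphism G (phi i);
  lk_src : forall i, frame_ok G m (k i);
  lk_lim : frame_ok G m (lmF k);
  lk_img : frame_ok G m (lmF (map_net phi k));
  lk_sep : separated phi k }.

End OneFilter.

Section ThirdLimit.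
Variables (I : Type) (U : set_system I).
Hypothesis UU : UltraFilter U.
Notation lm := (ulim H UU).
Notation lmF := (ulim_frame H UU).
Variables (phi : I -> V -> V) (k : I -> frame V).
Hypothesis lk : linked UU phi k.
Notation kh := (map_net phi k).
Notation K0 := (lmF k).
Notation KH := (lmF kh).
Let aut := lk_aut lk.
Let kP := lk_src lk.
Let K0P := lk_lim lk.
Let KHP := lk_img lk.

Let img (X : I -> V) : I -> V := fun i => phi i (X i).

Let adj_img (X : I -> V) : (\forall i \near U, adj (fv (k i)) (X i)) ->
  adj (fv KH) (lm (img X)).
Proof.
move=> vX; apply: lm_adj; apply: filterS vX => i.
by have [_ ->] := aut i.
Qed.

Lemma lm_third : lm (fun i => third (k i)) = third K0.
Proof.
have x0 := fun i => fv (k i).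
exact: (ev_lm (x := x0) (y := x0) (z := x0) (wd_d m_ge3 poly K0P _ _ _)).
Qed.

Lemma lm_img_third : lm (img (fun i => third (k i))) = third KH.
Proof.
have x0 := fun i => fv (k i).
rewrite -[RHS](ev_lm (x := x0) (y := x0) (z := x0) (wd_d m_ge3 poly KHP _ _ _)).
congr lm; apply: funext => i.
exact: (ev_aut m_ge3 poly (aut i) (wd_d m_ge3 poly (kP i) (fv (k i)) (fv (k i)) (fv (k i)))).
Qed.

(** Where the limit of third k is isolated in its panel, nets converging to it
    are eventually constant, up to a perspectivity to a fixed panel. *)
Lemma third_limit_isolated (O : set V) (Y : I -> V) :
  nbhs (third K0) O -> (forall P, O P -> adj (fv K0) P -> P = third K0) ->
  (\forall i \near U, adj (fv (k i)) (Y i)) -> lm Y = third K0 ->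
  lm (img Y) = third KH.
Proof.
move=> Onb Oiso vY YE.
have v0vo : dist (fv K0) (fvo K0) = m by case: K0P.
have vovo : dist (fvo K0) (fv K0) = m by rewrite dC.
have v0d : adj (fv K0) (third K0) := vd m_ge3 poly K0P.
have key (Z : I -> V) : (\forall i \near U, adj (fv (k i)) (Z i)) ->
    lm Z = third K0 ->
    \forall i \near U, Z i = pr (fv (k i)) (pr (fvo K0) (third K0)).
  move=> vZ ZE.
  have oZ : dist (fvo K0) (lm Z) = m.-1 by rewrite ZE dC; apply: (opp_adj m_ge3 poly v0vo).
  have oZi : \forall i \near U, dist (fvo K0) (Z i) = m.-1.
    by apply: (lm_distE (H := H) (UU := UU) (x := fun=> fvo K0)) => //; rewrite lm_cst.
  have lmo : lm (fun i => pr (fvo K0) (Z i)) = pr (fvo K0) (third K0).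
    by rewrite lm_pr lm_cst ?ZE // -ZE.
  have [adj_op _] := prM m_ge3 poly oZ; rewrite ZE in adj_op.
  have vp : dist (fv K0) (pr (fvo K0) (third K0)) = m.-1.
    by rewrite dC; apply: (opp_adj m_ge3 poly vovo).
  have lmv : lm (fun i => pr (fv K0) (pr (fvo K0) (Z i))) = third K0.
    by rewrite (lm_pr (x := fun=> fv K0)) lm_cst lmo // (persp m_ge3 poly v0vo v0d).
  have lO : \forall i \near U, O (pr (fv K0) (pr (fvo K0) (Z i))).
    by apply: (lm_nbhs (H := H) (UU := UU)); rewrite lmv.
  have vo_i : \forall i \near U, dist (fv (k i)) (fvo K0) = m.
    apply: (lm_distE (H := H) (UU := UU) (y := fun=> fvo K0)); first exact: leq_pred.
    by rewrite lm_cst.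
  near=> i.
  have oZ1 : dist (fvo K0) (Z i) = m.-1 by near: i.
  have [adj_oj _] := prM m_ge3 poly oZ1.
  have vj : dist (fv K0) (pr (fvo K0) (Z i)) = m.-1.
    by rewrite dC; apply: (opp_adj m_ge3 poly vovo).
  have [vw _] := prM m_ge3 poly vj.
  have wE : pr (fv K0) (pr (fvo K0) (Z i)) = third K0.
    by apply: Oiso => //; near: i.
  rewrite -wE (persp m_ge3 poly vovo adj_oj).
  apply: esym; apply: (persp m_ge3 poly); first by near: i.
  by near: i.
rewrite -lm_img_third; apply: lm_near.
have vd_i : \forall i \near U, adj (fv (k i)) (third (k i)).
  by apply: nearW => i; exact: vd (kP i).
have dE := key _ vd_i lm_third.
by apply: filterS2 (key Y vY YE) dE => i; rewrite /img => -> ->.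
Unshelve. all: by end_near.
Qed.


Lemma lmF_cst (J : Type) (W : set_system J) (WW : UltraFilter W) (K : frame V) :
  ulim_frame H WW (fun=> K) = K.
Proof. by rewrite /ulim_frame !lm_cst; case: K. Qed.

(** Division of T2 - T1 by T3; the boolean selects the auxiliary vertices. *)
Definition Tquotient b := Tdiv (Tu b) (Tu (~~ b)) T3 (Tsub T1 T2).

(** Of the two neighbours s and r of fc, at most one is on the way to q z. *)
Lemma auxiliary_vertex (z : V) : adj (fv KH) z -> exists b, forall x y,
  dist (ev G KH x y z (Tq T3)) (ev G KH x y z (Tu b)) = m.
Proof.
move=> vz; set q := ev G KH z z z (Tq T3).
have cq : dist (fc KH) q = m.-1 := q_c m_ge3 poly KHP vz.
have [cp pq] := prM m_ge3 poly cq.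
have [_ cs _ sr] := TuP m_ge3 poly KHP z z z true.
have [_ cr _ _] := TuP m_ge3 poly KHP z z z false.
have far u : adj (fc KH) u -> u <> pr (fc KH) q -> dist q u = m.
  by move=> cu up; rewrite dC; apply: (far_opp m_ge3 poly cq cp) => //; rewrite pq.
have [E|/eqP sN] := eqVneq (pr (fc KH) (fvo KH)) (pr (fc KH) q).
  by exists false => x y; apply: far => // E'; apply: sr; rewrite /= E -E'.
by exists true => x y; apply: far.
Qed.

(** Suppose that Y tends to zero while phi Y tends to z different from zero.  Among
    the infinitely many elements of the panel close to zero, all with images away
    from infinity, compactness gives P and Q distinct such that the images of P
    and Q are close enough for their difference divided by z to be close to zero.
    Then the difference of P and Q divided by Y does not tend to infinity, as its
    image is close to zero; multiplied by Y, which tends to zero, it tends to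
    zero.  So P and Q have difference zero. *)
Lemma third_limit_adherent (Y : I -> V) :
  (forall O, nbhs (third K0) O ->
    exists P, [/\ O P, adj (fv K0) P & P <> third K0]) ->
  (\forall i \near U, adj (fv (k i)) (Y i)) -> lm Y = third K0 ->
  lm (img Y) = third KH.
Proof.
move=> adh vY YE; apply: contrapT; set z := lm (img Y) => zNd.
have [Sc [Sd [Tc [Td' [[nSc nSd] [nTc nTd] sep]]]]] := lk_sep lk.
have vz : adj (fv KH) z by exact: adj_img.
have [b qu] := auxiliary_vertex vz; have {}qu P Q := qu P Q.
have qv : dist (ev G KH z z z (Tq T3)) (fv KH) = m := q_v m_ge3 poly KHP vz zNd.
(* an ultrafilter on the limit panel that converges to third K0 and avoids it *)
pose B := [set P | adj (fv K0) P /\ P <> third K0].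
have Bprop : ProperFilter (within B (nbhs (third K0))).
  apply: Build_ProperFilter_ex => A; rewrite /within /= => /adh[P [AP vP PN]].
  by exists P; apply: AP.
have [W [WU sW]] := ultraFilterLemma Bprop.
have W_B : \forall P \near W, B P by apply: sW; exact: withinT.
have W_cvg : W --> third K0.
  by move=> A nA; apply: sW; apply: filterS nA => P.
have W_lm : ulim H WU id = third K0 by apply: lm_eq => A /W_cvg.
have /choice[X XP] : forall P, exists X : I -> V, adj (fv K0) P ->
    lm X = P /\ \forall i \near U, adj (fv (k i)) (X i).
  move=> P; have [/panel_lift[X XP]|no] := pselect (adj (fv K0) P); first by exists X.
  by exists (fun=> P) => /no.
pose h P := lm (img (X P)); pose R := ulim H WU h.
have W_h : \forall P \near W, adj (fv KH) (h P).
  by apply: filterS W_B => P [vP _]; apply: adj_img; case: (XP P vP).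
have vR : adj (fv KH) R.
  rewrite -(lm_cst H WU (fv KH)); exact: lm_adj.
have RNc : R <> fc KH.
  move=> Rc; have WTc : \forall P \near W, interior Tc (h P).
    by apply: (lm_nbhs (H := H) (UU := WU)); rewrite -/R Rc; apply/nbhs_interior.
  have WSd : \forall P \near W, interior Sd P.
    by apply: W_cvg; apply/nbhs_interior.
  have /filter_ex[P [hP SP [vP _]]] : \forall P \near W,
      [/\ interior Tc (h P), interior Sd P & B P].
    by apply: filterS3 WTc WSd W_B.
  have [XE vX] := XP P vP.
  have S_X : \forall i \near U, Sd (X P i).
    by apply: (lm_nbhs (H := H) (UU := UU)); rewrite XE.
  have T_X : \forall i \near U, Tc (phi i (X P i)).
    exact: (lm_nbhs (H := H) (UU := UU)) hP.
  have /filter_ex[i [[sepi vXi] [Si Ti]]] : \forall i \near U,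
      ((forall Z, adj (fv (k i)) Z -> ~ (Sd Z /\ Tc (phi i Z)) /\
         ~ (Sc Z /\ Td' (phi i Z))) /\ adj (fv (k i)) (X P i)) /\
      (Sd (X P i) /\ Tc (phi i (X P i))).
    by do ![apply: filterI => //].
  by have [+ _] := sepi _ vXi; apply.
have wdT P Q : adj (fv KH) P -> P <> fc KH -> adj (fv KH) Q ->
    wd G m KH P Q z (Tquotient b) /\ adj (fv KH) (ev G KH P Q z (Tquotient b)).
  move=> vP Pc vQ.
  have [ws vs] := @wd_sub _ _ _ m_ge3 poly KH KHP P Q z T1 T2 Logic.I vP Pc Logic.I vQ.
  exact: (@wd_div _ _ _ m_ge3 poly KH KHP P Q z b T3 (Tsub T1 T2)
    Logic.I vz ws vs qv (qu P Q)).
have valRR : ev G KH R R z (Tquotient b) = third KH.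
  have RR := sub_diag m_ge3 poly KHP vR RNc.
  exact: (@ev_div_d _ _ _ m_ge3 poly KH KHP R R z b T3 (Tsub T1 T2) vz RR qv).
have lmQ : ulim H WU (fun Q => ev G KH R (h Q) z (Tquotient b)) = third KH.
  rewrite -valRR; have := @ev_lm V G m H _ W WU (fun=> KH) (fun=> R) h (fun=> z) (Tquotient b).
  rewrite lmF_cst !lm_cst; apply; exact: (proj1 (wdT _ _ vR RNc vR)).
have /filter_ex[Q [TQ [vQ QNd] vhQ]] : \forall Q \near W,
    [/\ interior Td' (ev G KH R (h Q) z (Tquotient b)), B Q & adj (fv KH) (h Q)].
  apply: filterS3 (_ : \forall Q \near W, interior Td' (ev G KH R (h Q) z (Tquotient b)))
    W_B W_h => //.
  by apply: (lm_nbhs (H := H) (UU := WU)); rewrite lmQ; apply/nbhs_interior.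
have lmP : ulim H WU (fun P => ev G KH (h P) (h Q) z (Tquotient b)) =
    ev G KH R (h Q) z (Tquotient b).
  have := @ev_lm V G m H _ W WU (fun=> KH) h (fun=> h Q) (fun=> z) (Tquotient b).
  rewrite lmF_cst !lm_cst; apply; exact: (proj1 (wdT _ _ vR RNc vhQ)).
have [P [TP [vP _] [PQ Pc] vhP hPc]] : exists P,
    [/\ interior Td' (ev G KH (h P) (h Q) z (Tquotient b)), B P, P <> Q /\ P <> fc K0,
       adj (fv KH) (h P) & h P <> fc KH].
  have W_T : \forall P \near W, interior Td' (ev G KH (h P) (h Q) z (Tquotient b)).
    by apply: (lm_nbhs (H := H) (UU := WU)); rewrite lmP; exact: nbhs_interior TQ.
  have W_Q P : third K0 <> P -> \forall P' \near W, P' <> P.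
    by move=> NP; apply: (@lm_neq V G m H V W WU id (fun=> P)); rewrite W_lm lm_cst.
  have W_c : \forall P \near W, h P <> fc KH.
    by apply: (@lm_neq V G m H V W WU h (fun=> fc KH)); rewrite lm_cst.
  apply: (@filter_ex _ W); near=> P; split; [| |split| |]; near: P.
  - exact: W_T.
  - exact: W_B.
  - exact: W_Q (nesym QNd).
  - exact: W_Q (d_c m_ge3 poly K0P).
  - exact: W_h.
  - exact: W_c.
have [XPE vXP] := XP P vP; have [XQE vXQ] := XP Q vQ.
pose ev_i t i := ev G (k i) (X P i) (X Q i) (Y i) t.
pose evh_i t i := ev G (kh i) (phi i (X P i)) (phi i (X Q i)) (phi i (Y i)) t.
have lmT : lm (ev_i (Tsub T1 T2)) = ev G K0 P Q (lm Y) (Tsub T1 T2).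
  have [w _] := @wd_sub _ _ _ m_ge3 poly K0 K0P P Q (lm Y) T1 T2 Logic.I vP Pc Logic.I vQ.
  have := @ev_lm V G m H I U UU k (X P) (X Q) Y (Tsub T1 T2).
  by rewrite XPE XQE; apply.
have lmh t : wd G m KH (h P) (h Q) z t -> lm (evh_i t) = ev G KH (h P) (h Q) z t.
  exact: (@ev_lm V G m H I U UU kh (img (X P)) (img (X Q)) (img Y)).
have lm_q : lm (evh_i (Tq T3)) = ev G KH (h P) (h Q) z (Tq T3).
  by apply: lmh; exact: (@wd_q _ _ _ m_ge3 poly KH KHP _ _ _ T3 Logic.I vz).
have lm_u : lm (evh_i (Tu b)) = ev G KH (h P) (h Q) z (Tu b).
  by apply: lmh; case: (TuP m_ge3 poly KHP (h P) (h Q) z b).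
have qv_i : \forall i \near U, dist (evh_i (Tq T3) i) (fv (kh i)) = m.
  by apply: (lm_distE (H := H) (UU := UU)); [exact: leq_pred|rewrite lm_q].
have qu_i : \forall i \near U, dist (evh_i (Tq T3) i) (evh_i (Tu b) i) = m.
  by apply: (lm_distE (H := H) (UU := UU)); [exact: leq_pred|rewrite lm_q lm_u].
have T_i : \forall i \near U, Td' (evh_i (Tquotient b) i).
  by apply: (lm_nbhs (H := H) (UU := UU)); rewrite lmh //; case: (wdT _ _ vhP hPc vhQ).
have Pc_i : \forall i \near U, X P i <> fc (k i).
  by apply: (lm_neq (H := H) (UU := UU)); rewrite XPE.
have good : \forall i \near U, adj (fv (k i)) (ev_i (Tquotient b) i) /\
   ev G (k i) (Y i) (ev_i (Tquotient b) i) (Y i) (Tmul (Tu b) (Tu (~~ b)) T1 T2) =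
     ev_i (Tsub T1 T2) i /\ Td' (phi i (ev_i (Tquotient b) i)).
  near=> i.
  have vYi : adj (fv (k i)) (Y i) by near: i.
  have wq : wd G m (k i) (X P i) (X Q i) (Y i) (Tq T3).
    exact: (@wd_q _ _ _ m_ge3 poly (k i) (kP i) _ _ _ T3 Logic.I vYi).
  have wu : wd G m (k i) (X P i) (X Q i) (Y i) (Tu b).
    by case: (TuP m_ge3 poly (kP i) (X P i) (X Q i) (Y i) b).
  have qv1 : dist (ev_i (Tq T3) i) (fv (k i)) = m.
    rewrite -(dist_aut poly (aut i)) (ev_aut m_ge3 poly (aut i) wq).
    by near: i.
  have qu1 : dist (ev_i (Tq T3) i) (ev_i (Tu b) i) = m.
    rewrite -(dist_aut poly (aut i)) (ev_aut m_ge3 poly (aut i) wq).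
    by rewrite (ev_aut m_ge3 poly (aut i) wu); near: i.
  have [ws vs] : wd G m (k i) (X P i) (X Q i) (Y i) (Tsub T1 T2) /\
      adj (fv (k i)) (ev_i (Tsub T1 T2) i).
    have vX1 : adj (fv (k i)) (X P i) by near: i.
    have vX2 : adj (fv (k i)) (X Q i) by near: i.
    have Xc : X P i <> fc (k i) by near: i.
    exact: (@wd_sub _ _ _ m_ge3 poly (k i) (kP i) _ _ _ T1 T2).
  have [wv vv] := @wd_div _ _ _ m_ge3 poly (k i) (kP i) _ _ _ b T3 (Tsub T1 T2)
    Logic.I vYi ws vs qv1 qu1.
  split; first exact: vv.
  split; last by rewrite (ev_aut m_ge3 poly (aut i) wv); near: i.
  have := @ev_mul_div _ _ _ m_ge3 poly (k i) (kP i) _ _ _ b T3 (Tsub T1 T2)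
    vYi vs qv1 qu1.
  by rewrite /ev_i /Tquotient; case: (b).
(* the quotient stays away from the excluded vertex fc K0, so that multiplying
   it back by Y, which tends to zero, gives zero in the limit *)
have vZ : adj (fv K0) (lm (ev_i (Tquotient b))).
  by apply: lm_adj; apply: filterS good => i [].
have Zc : lm (ev_i (Tquotient b)) <> fc K0.
  move=> ZE; have Sc_i : \forall i \near U, Sc (ev_i (Tquotient b) i).
    by apply: (lm_nbhs (H := H) (UU := UU)); rewrite ZE.
  have /filter_ex[i []] : \forall i \near U, False /\ True.
    by apply: filterS3 sep good Sc_i => i sepi [/sepi[_ nS] [_ Ti]] Si; case: nS.
  by [].
have := @wd_mul_d _ _ _ m_ge3 poly K0 K0P (lm Y) (lm (ev_i (Tquotient b))) (lm Y) b T1 T2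
  Logic.I YE Logic.I vZ Zc.
move=> [wm mE].
apply: PQ; apply: esym; apply: (sub_eq m_ge3 poly K0P vP Pc vQ).
rewrite -[LHS]lmT -[RHS]mE -ev_lm //; apply: lm_near.
by apply: filterS good => i [_ [-> _]].
Unshelve. all: by end_near.
Qed.

Lemma third_limit (Y : I -> V) :
  (\forall i \near U, adj (fv (k i)) (Y i)) -> lm Y = third K0 ->
  lm (img Y) = third KH.
Proof.
move=> vY YE.
have [adh|] := pselect (forall O, nbhs (third K0) O ->
    exists P, [/\ O P, adj (fv K0) P & P <> third K0]); first exact: third_limit_adherent.
move=> /existsNP[N /not_implyP[nN iso]]; apply: (third_limit_isolated nN) vY YE => P NP vP.
by apply: contrapT => Pd; apply: iso; exists P.
Qed.

End ThirdLimit.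
Section Symmetries.
Variables (I : Type) (U : set_system I).
Hypothesis UU : UltraFilter U.
Notation lm := (ulim H UU).
Notation lmF := (ulim_frame H UU).

Lemma linked_inv (phi psi : I -> V -> V) (k : I -> frame V) :
  (forall i, cancel (phi i) (psi i)) -> (forall i, cancel (psi i) (phi i)) ->
  linked UU phi k ->
  linked UU psi (map_net phi k) /\ map_net psi (map_net phi k) = k.
Proof.
move=> phiK psiK lk.
have kE : map_net psi (map_net phi k) = k.
  apply: funext => i; rewrite /map_net /map_frame /= !phiK.
  by case: (k i).
have aut := lk_aut lk; split=> //; split; rewrite ?kE.
- move=> i; have [_ fa] := aut i; split; last by move=> a b; rewrite -fa !psiK.
  by exists (phi i).
- by move=> i; exact: (frame_ok_aut m_ge3 poly (aut i) (lk_src lk i)).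
- exact: lk_img lk.
- exact: lk_lim lk.
have [Sc [Sd [Tc [Td' [nS nT sep]]]]] := lk_sep lk.
exists Tc, Td', Sc, Sd; rewrite kE; split=> //.
apply: filterS sep => i sepi X vX.
have [_ fa] := aut i.
have [|n1 n2] := sepi (psi i X); first by rewrite -fa psiK.
by rewrite psiK in n1 n2; split=> -[? ?]; [apply: n2|apply: n1].
Qed.

Lemma lmF_swap (k : I -> frame V) : frame_ok G m (lmF k) ->
  lmF (fun i => swap_frame G (k i)) = swap_frame G (lmF k).
Proof.
move=> kP; have vc : adj (fv (lmF k)) (fc (lmF k)) by case: kP => -[].
pose x0 := fun i => fv (k i).
have E t : wd G m (lmF k) (lm x0) (lm x0) (lm x0) t ->
    lm (fun i => ev G (k i) (x0 i) (x0 i) (x0 i) t) =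
    ev G (lmF k) (lm x0) (lm x0) (lm x0) t by exact: ev_lm.
have wd := wd_d m_ge3 poly kP (lm x0) (lm x0) (lm x0).
have wo := wd_om m_ge3 poly kP (lm x0) (lm x0) (lm x0).
rewrite /swap_frame {1}/ulim_frame /=; congr Frame.
- exact: (E Td).
- by apply: (E (Pr Tvo Tc)); split=> //=; exact: (panel_vo m_ge3 poly kP vc).
apply: (E (Pr Td Tom)); split=> //.
exact: (panel_om m_ge3 poly kP (vd m_ge3 poly kP)).
Qed.

Lemma swap_frame_aut (f : V -> V) (k : frame V) : is_automorphism G f ->
  frame_ok G m k -> map_frame f (swap_frame G k) = swap_frame G (map_frame f k).
Proof.
move=> aut kP; have vc : adj (fv k) (fc k) by case: kP => -[].
pose x0 := fv k.
have E t : wd G m k x0 x0 x0 t ->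
    f (ev G k x0 x0 x0 t) = ev G (map_frame f k) (f x0) (f x0) (f x0) t.
  exact: ev_aut.
have wd := wd_d m_ge3 poly kP x0 x0 x0.
have wo := wd_om m_ge3 poly kP x0 x0 x0.
rewrite /swap_frame {1}/map_frame; congr Frame.
- exact: (E Td).
- by apply: (E (Pr Tvo Tc)); split=> //=; exact: (panel_vo m_ge3 poly kP vc).
apply: (E (Pr Td Tom)); split=> //.
exact: (panel_om m_ge3 poly kP (vd m_ge3 poly kP)).
Qed.

(** In the swapped frame, third_limit applies to nets that tend to infinity. *)
Lemma linked_swap (phi : I -> V -> V) (k : I -> frame V) : linked UU phi k ->
  linked UU phi (fun i => swap_frame G (k i)).
Proof.
move=> lk; have aut := lk_aut lk; have kP := lk_src lk.
have [ok0 th0] := swap_frame_ok m_ge3 poly (lk_lim lk).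
have [okh thh] := swap_frame_ok m_ge3 poly (lk_img lk).
have E0 := lmF_swap (lk_lim lk); have Eh := lmF_swap (lk_img lk).
have Eimg : map_net phi (fun i => swap_frame G (k i)) =
    fun i => swap_frame G (map_net phi k i).
  by apply: funext => i; exact: swap_frame_aut.
split; rewrite ?Eimg ?E0 ?Eh //.
  by move=> i; case: (swap_frame_ok m_ge3 poly (kP i)).
have [Sc [Sd [Tc [Td' [[nSc nSd] [nTc nTd] sep]]]]] := lk_sep lk.
exists Sd, Sc, Td', Tc; rewrite Eimg E0 Eh /third th0 thh; split=> //.
by apply: filterS sep => i sepi X /sepi[n1 n2]; split.
Qed.

(** Nets that tend to infinity are dealt with by the swapped frame; otherwise the
    difference of nets with the same limit tends to zero, hence so does the
    difference of their images. *)
Lemma panel_limit (phi psi : I -> V -> V) (k : I -> frame V) (X X' : I -> V) :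
  (forall i, cancel (phi i) (psi i)) -> (forall i, cancel (psi i) (phi i)) ->
  linked UU phi k ->
  (\forall i \near U, adj (fv (k i)) (X i)) ->
  (\forall i \near U, adj (fv (k i)) (X' i)) -> lm X = lm X' ->
  lm (fun i => phi i (X i)) = lm (fun i => phi i (X' i)).
Proof.
move=> phiK psiK lk vX vX' XX'.
have aut := lk_aut lk; have kP := lk_src lk.
have K0P := lk_lim lk; have KHP := lk_img lk.
have lks := linked_swap lk.
have swap_th (K : frame V) : frame_ok G m K -> third (swap_frame G K) = fc K.
  by move=> KP; case: (swap_frame_ok m_ge3 poly KP).
have Eimg : map_net phi (fun i => swap_frame G (k i)) =
    fun i => swap_frame G (map_net phi k i).
  by apply: funext => i; exact: swap_frame_aut.
have to_c Z : (\forall i \near U, adj (fv (k i)) (Z i)) -> lm Z = fc (lmF k) ->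
    lm (fun i => phi i (Z i)) = fc (lmF (map_net phi k)).
  move=> vZ Zc; rewrite -(swap_th _ KHP) -(lmF_swap KHP) -Eimg.
  by apply: (third_limit lks) => //; rewrite lmF_swap // swap_th.
have of_c Z : (\forall i \near U, adj (fv (k i)) (Z i)) ->
    lm (fun i => phi i (Z i)) = fc (lmF (map_net phi k)) -> lm Z = fc (lmF k).
  move=> vZ Zc; have [lki kE] := linked_inv phiK psiK lks.
  have -> : lm Z = lm (fun i => psi i (phi i (Z i))).
    by congr lm; apply: funext => i; rewrite phiK.
  rewrite -(swap_th _ K0P) -(lmF_swap K0P) -kE.
  apply: (third_limit lki); last by rewrite Eimg lmF_swap // swap_th.
  by apply: filterS vZ => i; have [_ fa] := aut i; rewrite -{1}fa.
have [Xc|Xc] := eqVneq (lm X) (fc (lmF k)).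
  by rewrite !to_c // -XX'.
have hX : lm (fun i => phi i (X i)) <> fc (lmF (map_net phi k)).
  by move=> /(of_c _ vX); apply/eqP.
have img_adj Z : (\forall i \near U, adj (fv (k i)) (Z i)) ->
    adj (fv (lmF (map_net phi k))) (lm (fun i => phi i (Z i))).
  move=> vZ; apply: lm_adj; apply: filterS vZ => i.
  by have [_ ->] := aut i.
have v0X : adj (fv (lmF k)) (lm X) by exact: lm_adj.
pose S i := ev G (k i) (X i) (X' i) (X i) (Tsub T1 T2).
have SE : lm S = third (lmF k).
  have [w _] := @wd_sub _ _ _ m_ge3 poly _ K0P (lm X) (lm X) (lm X) T1 T2
    Logic.I v0X (elimN eqP Xc) Logic.I v0X.
  have := @ev_lm V G m H I U UU k X X' X (Tsub T1 T2).
  rewrite -XX' => ->//; exact: (sub_diag m_ge3 poly K0P v0X (elimN eqP Xc)).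
have Xc_i : \forall i \near U, X i <> fc (k i).
  by apply: (lm_neq (H := H) (UU := UU)); exact/eqP.
have wS : \forall i \near U, wd G m (k i) (X i) (X' i) (X i) (Tsub T1 T2) /\
    adj (fv (k i)) (S i).
  apply: filterS3 vX vX' Xc_i => i a b c.
  exact: (@wd_sub _ _ _ m_ge3 poly _ (kP i) _ _ _ T1 T2 Logic.I a c Logic.I b).
have hS : lm (fun i => phi i (S i)) = third (lmF (map_net phi k)).
  by apply: (third_limit lk) => //; apply: filterS wS => i [].
have [w _] := @wd_sub _ _ _ m_ge3 poly _ KHP (lm (fun i => phi i (X i)))
  (lm (fun i => phi i (X' i))) (lm (fun i => phi i (X i))) T1 T2
  Logic.I (img_adj _ vX) hX Logic.I (img_adj _ vX').
apply: esym; apply: (sub_eq m_ge3 poly KHP (img_adj _ vX) hX (img_adj _ vX')).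
rewrite -[RHS]hS -[LHS](ev_lm w); apply: lm_near.
by apply: filterS wS => i [wi _]; rewrite /S (ev_aut m_ge3 poly (aut i) wi).
Qed.

End Symmetries.
End Panel.

(** * From one panel to all vertices *)

Section Propagation.
Variables (V : topologicalType) (G : typed_graph V) (m : nat).
Hypothesis H : compact_building G m.

Notation dist := (dist G).
Notation adj := (adj G).
Notation pr := (pr G).
Let m_ge3 := cb_m H.
Let poly := cb_polygon H.
Let conn := polygon_conn poly.
Let dC := distC conn.

Variables (I : Type) (U : set_system I).
Hypothesis UU : UltraFilter U.
Notation lm := (ulim H UU).
Notation lmF := (ulim_frame H UU).

Variable phi : I -> V -> V.
Hypothesis aut : forall i, is_automorphism G (phi i).

Definition img (x : I -> V) : I -> V := fun i => phi i (x i).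

Definition opp2 (a b : I -> V) : Prop :=
  dist (lm a) (lm b) = m /\ dist (lm (img a)) (lm (img b)) = m.

Definition faithful (a : I -> V) : Prop := forall X X' : I -> V,
  (\forall i \near U, adj (a i) (X i)) -> (\forall i \near U, adj (a i) (X' i)) ->
  lm X = lm X' <-> lm (img X) = lm (img X').

(** Here the second net may live in an infinitely close panel, as needed to compare
    geodesics that lead to infinitely close vertices. *)
Definition good (a : I -> V) : Prop := forall a' X X' : I -> V,
  lm a' = lm a -> lm (img a') = lm (img a) ->
  (\forall i \near U, adj (a i) (X i)) -> (\forall i \near U, adj (a' i) (X' i)) ->
  lm X = lm X' <-> lm (img X) = lm (img X').

Lemma good_faithful (a : I -> V) : good a -> faithful a.
Proof. by move=> ga X X'; exact: ga. Qed.

Lemma adj_img (a X : I -> V) : (\forall i \near U, adj (a i) (X i)) ->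
  \forall i \near U, adj (img a i) (img X i).
Proof. by apply: filterS => i; have [_ fa] := aut i; rewrite -[adj (a i) _]fa. Qed.

Lemma opp2C (a b : I -> V) : opp2 a b -> opp2 b a.
Proof. by move=> [ab hab]; split; rewrite dC. Qed.

Lemma lm_persp (a b X : I -> V) : dist (lm a) (lm b) = m ->
  (\forall i \near U, adj (b i) (X i)) ->
  [/\ \forall i \near U, dist (a i) (X i) = m.-1,
      \forall i \near U, adj (a i) (pr (a i) (X i)) &
      pr (lm b) (lm (fun i => pr (a i) (X i))) = lm X].
Proof.
move=> ab bX; have ba : dist (lm b) (lm a) = m by rewrite dC.
have bX0 : adj (lm b) (lm X) by exact: lm_adj.
have aX0 : dist (lm a) (lm X) = m.-1 by rewrite dC; exact: (opp_adj m_ge3 poly ba).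
have aX : \forall i \near U, dist (a i) (X i) = m.-1.
  exact: (lm_distE (H := H) (UU := UU)) aX0.
split=> //; first by apply: filterS aX => i /(prM m_ge3 poly)[].
by rewrite lm_pr // (persp m_ge3 poly).
Qed.

Lemma lm_img_pr (a X : I -> V) : (\forall i \near U, dist (a i) (X i) = m.-1) ->
  lm (img (fun i => pr (a i) (X i))) = lm (fun i => pr (img a i) (img X i)).
Proof.
move=> aX; apply: lm_near; apply: filterS aX => i aXi.
exact: (pr_aut m_ge3 poly (aut i)).
Qed.

(** Perspectivities are continuous and commute with automorphisms. *)
Lemma persp_good (a b : I -> V) : faithful a -> opp2 a b -> good b.
Proof.
move=> fa [ab hab] b' X X' bb hbb bX bX'.
have ab' : dist (lm a) (lm b') = m by rewrite bb.
have hab' : dist (lm (img a)) (lm (img b')) = m by rewrite hbb.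
have [dX aX XE] := lm_persp ab bX.
have [dX' aX' XE'] := lm_persp ab' bX'.
have [_ _ hXE] := lm_persp hab (adj_img bX).
have [_ _ hXE'] := lm_persp hab' (adj_img bX').
have [faX faX'] := fa _ _ aX aX'; rewrite !lm_img_pr // in faX faX'.
split=> E.
  rewrite -hXE -hXE' hbb faX //.
  have XL : dist (lm a) (lm X) = m.-1.
    by rewrite dC; apply: (opp_adj m_ge3 poly (x := lm b)); [rewrite dC|exact: lm_adj].
  by rewrite !lm_pr -?E.
rewrite -XE -XE' bb faX' //.
have XL : dist (lm (img a)) (lm (img X)) = m.-1.
  rewrite dC; apply: (opp_adj m_ge3 poly (x := lm (img b))); first by rewrite dC.
  by apply: lm_adj; exact: adj_img.
by rewrite !lm_pr -?E.
Qed.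

Lemma faithful_good (a b : I -> V) : faithful a -> opp2 a b -> good a /\ good b.
Proof.
move=> fa ab; have gb := persp_good fa ab; split=> //.
exact: persp_good (good_faithful gb) (opp2C ab).
Qed.

Definition spread (a : I -> V) : Prop := good a /\ exists w, opp2 a w.

(** If b and x are limits of distinct elements of the panel of a, then, as the
    building is thick, some vertex is opposite both, and goodness passes from b
    to x by two perspectivities. *)
Lemma spread_step (a b x : I -> V) : spread a -> spread b ->
  (\forall i \near U, adj (a i) (b i)) -> (\forall i \near U, adj (a i) (x i)) ->
  spread x.
Proof.
move=> [ga [oa a_oa]] [gb [ob b_ob]] ab ax.
have fin y : opp2 y b -> opp2 y x -> spread x.
  move=> yb yx; have gy := persp_good (good_faithful gb) (opp2C yb).
  split; first exact: persp_good (good_faithful gy) yx.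
  by exists y; exact: opp2C.
have [E|/eqP bx] := eqVneq (lm b) (lm x).
  apply: (fin ob); first exact: opp2C.
  have hE : lm (img b) = lm (img x) by apply/(good_faithful ga ab ax).
  by apply: opp2C; case: b_ob => ? ?; split; rewrite -?E -?hE.
have hbx : lm (img b) <> lm (img x) by move=> /(good_faithful ga ab ax).
have [f0 [af0 f0b f0x]] := cb_thick H (lm a) (lm b) (lm x).
have [f [fE af]] := panel_lift af0.
have hfb : lm (img f) <> lm (img b).
  by move=> /(good_faithful ga af ab); rewrite fE.
have hfx : lm (img f) <> lm (img x).
  by move=> /(good_faithful ga af ax); rewrite fE.
have opp_pr (a' oa' f' z' : I -> V) : dist (lm a') (lm oa') = m ->
    (\forall i \near U, adj (a' i) (f' i)) -> (\forall i \near U, adj (a' i) (z' i)) ->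
    lm f' <> lm z' -> dist (lm (fun i => pr (oa' i) (f' i))) (lm z') = m.
  move=> ao af' az' fz.
  have oa'_a : dist (lm oa') (lm a') = m by rewrite dC.
  have [_ oj pE] := lm_persp oa'_a af'.
  set j := lm (fun i => pr (oa' i) (f' i)) in pE *.
  have aj : dist (lm a') j = m.-1.
    by rewrite dC; apply: (opp_adj m_ge3 poly oa'_a); exact: lm_adj.
  have [ap pj] := prM m_ge3 poly aj; rewrite pE in ap pj.
  rewrite dC; apply: (far_opp m_ge3 poly aj ap); rewrite ?pj //; first exact: lm_adj.
  exact: nesym.
have oaf : \forall i \near U, dist (oa i) (f i) = m.-1.
  by have [] := lm_persp (proj1 (opp2C a_oa)) af.
have y2 z : (\forall i \near U, adj (a i) (z i)) -> lm f <> lm z ->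
    lm (img f) <> lm (img z) -> opp2 (fun i => pr (oa i) (f i)) z.
  move=> az fz hfz; have [d1 d2] := a_oa; split; first exact: opp_pr d1 af az fz.
  rewrite lm_img_pr //; exact: opp_pr d2 (adj_img af) (adj_img az) hfz.
apply: (fin (fun i => pr (oa i) (f i))); first by apply: y2; rewrite ?fE.
by apply: y2; rewrite ?fE.
Qed.

Lemma all_spread (v c : I -> V) : (forall i, adj (v i) (c i)) ->
  spread v -> spread c -> forall x, spread x.
Proof.
move=> vc sv sc.
suff main n : forall x, (\forall i \near U, dist (x i) (v i) = n) -> spread x.
  move=> x; have [|n _ xn] := @ultra_bounded I U (fun i => dist (x i) (v i)) m UU.
    by apply: nearW => i; exact: dist_le.
  exact: main xn.
elim/ltn_ind: n => -[|[|n]] IH x xn.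
- have xv : \forall i \near U, x i = v i by apply: filterS xn => i /dist0; exact.
  have E : lm x = lm v by exact: lm_near.
  have hE : lm (img x) = lm (img v).
    by apply: lm_near; apply: filterS xv => i; rewrite /img => ->.
  have [gv [w [vw hvw]]] := sv; split; last by exists w; split; rewrite ?E ?hE.
  move=> x' X X'; rewrite E hE => xx hxx xX xX'; apply: (gv x') => //.
  by apply: filterS2 xv xX => i ->.
- apply: (spread_step sv sc); first exact: nearW.
  by apply: filterS xn => i xi; rewrite adj_sym; exact: adj_dist xi.
pose x1 i := pr (x i) (v i); pose x2 i := pr (x1 i) (v i).
have x1P : \forall i \near U, adj (x i) (x1 i) /\ dist (x1 i) (v i) = n.+1.
  apply: filterS xn => i xi; have [|? E] := @prP _ G m m_ge3 poly (x i) (v i).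
    by rewrite xi.
  by split=> //; apply: succn_inj; rewrite -xi E.
have x2P : \forall i \near U, adj (x1 i) (x2 i) /\ dist (x2 i) (v i) = n.
  apply: filterS x1P => i [_ xi]; have [|? E] := @prP _ G m m_ge3 poly (x1 i) (v i).
    by rewrite xi.
  by split=> //; apply: succn_inj; rewrite -xi E.
apply: (@spread_step x1 x2 x).
- by apply: (IH n.+1) => //; apply: filterS x1P => i [].
- by apply: (IH n) => //; apply: filterS x2P => i [].
- by apply: filterS x2P => i [].
by apply: filterS x1P => i [+ _]; rewrite adj_sym.
Qed.

(** Follow geodesics from x and y back to a fixed neighbour j of a vertex opposite
    to the common limit: they stay infinitely close to each other up to j. *)
Lemma spread_eq (x y : I -> V) : (forall z, spread z) -> lm x = lm y ->
  lm (img x) = lm (img y).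
Proof.
move=> sp xy; have [w xw] := opp_exists H (lm x).
have [j wj] := polygon_edge poly w.
have xj : dist (lm x) j = m.-1.
  by rewrite dC; apply: (opp_adj m_ge3 poly (x := w)) wj; rewrite dC.
have near_j z : lm z = lm x -> \forall i \near U, dist (z i) j = m.-1.
  move=> zx; apply: (lm_distE (H := H) (UU := UU) (y := fun=> j)) => //.
  by rewrite lm_cst zx.
have xj_i := near_j x erefl; have yj_i := near_j y (esym xy).
have : m.-1 < m by lia.
move: {w xw wj near_j} (m.-1) xj xj_i yj_i => n.
elim: n x y xy => [|n IH] x y xy xj xj_i yj_i nm.
  apply: lm_near; apply: filterS2 xj_i yj_i => i xi yi.
  by rewrite /img (dist0 conn xi) (dist0 conn yi).
have toward z : (\forall i \near U, dist (z i) j = n.+1) ->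
    \forall i \near U, adj (z i) (pr (z i) j) /\ dist (pr (z i) j) j = n.
  apply: filterS => i zi; have [|? E] := @prP _ G m m_ge3 poly (z i) j.
    by rewrite zi.
  by split=> //; apply: succn_inj; rewrite -zi E.
have lim z : lm z = lm x -> (\forall i \near U, dist (z i) j = n.+1) ->
    pr (lm x) j = lm (fun i => pr (z i) j).
  move=> zx /toward zP; apply: (pr_uniq m_ge3 poly); rewrite ?xj //.
    by rewrite -zx; apply: lm_adj; apply: filterS zP => i [].
  have := @lm_dist_le V G m H I U UU n (fun i => pr (z i) j) (fun=> j).
  by rewrite lm_cst; apply; apply: filterS zP => i [_ ->].
have E : lm (fun i => pr (x i) j) = lm (fun i => pr (y i) j).
  by rewrite -!lim.
have hE : lm (img (fun i => pr (x i) j)) = lm (img (fun i => pr (y i) j)).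
  apply: IH => //; last exact: ltnW.
  - rewrite -lim //; have [|_] := @prP _ G m m_ge3 poly (lm x) j; rewrite ?xj //.
    by move=> [].
  - by apply: filterS (toward _ xj_i) => i [].
  - by apply: filterS (toward _ yj_i) => i [].
have [gx _] := sp (fun i => pr (x i) j).
apply: (proj1 (gx (fun i => pr (y i) j) x y (esym E) (esym hE) _ _)) => //.
  by apply: filterS (toward _ xj_i) => i [+ _]; rewrite adj_sym.
by apply: filterS (toward _ yj_i) => i [+ _]; rewrite adj_sym.
Qed.

End Propagation.

Section Linked.
Variables (V : topologicalType) (G : typed_graph V) (m : nat).
Hypothesis H : compact_building G m.
Let m_ge3 := cb_m H.
Let poly := cb_polygon H.
Variables (I : Type) (U : set_system I).
Hypothesis UU : UltraFilter U.
Notation lm := (ulim H UU).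
Notation lmF := (ulim_frame H UU).

Lemma linked_spread (phi psi : I -> V -> V) (k : I -> frame V) :
  (forall i, cancel (phi i) (psi i)) -> (forall i, cancel (psi i) (phi i)) ->
  linked H UU phi k -> spread H UU phi (fun i => fv (k i)).
Proof.
move=> phiK psiK lk; have aut := lk_aut lk.
have psi_phi (Z : I -> V) : (fun i => psi i (phi i (Z i))) = Z.
  by apply: funext => i; rewrite phiK.
have opp : opp2 H UU phi (fun i => fv (k i)) (fun i => fvo (k i)).
  by split; [case: (lk_lim lk)|case: (lk_img lk)].
have fth : faithful H UU phi (fun i => fv (k i)).
  move=> X X' vX vX'; split; first exact: panel_limit phiK psiK lk vX vX'.
  have [lki _] := linked_inv phiK psiK lk.
  move=> /(panel_limit psiK phiK lki (adj_img UU aut vX) (adj_img UU aut vX')).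
  by rewrite /img !psi_phi.
split; last by exists (fun i => fvo (k i)).
by have [] := faithful_good aut fth opp.
Qed.

(** Conditions at two adjacent panels make phi continuous in the limit. *)
Lemma linked_continuous (phi psi : I -> V -> V) (k : I -> frame V) :
  (forall i, cancel (phi i) (psi i)) -> (forall i, cancel (psi i) (phi i)) ->
  linked H UU phi k -> linked H UU phi (fun i => flip_frame (k i)) ->
  forall x y : I -> V, lm x = lm y <->
    lm (fun i => phi i (x i)) = lm (fun i => phi i (y i)).
Proof.
move=> phiK psiK lk lkf.
have psi_phi (Z : I -> V) : (fun i => psi i (phi i (Z i))) = Z.
  by apply: funext => i; rewrite phiK.
have main f g (k' : I -> frame V) : (forall i, cancel (f i) (g i)) ->
    (forall i, cancel (g i) (f i)) -> linked H UU f k' ->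
    linked H UU f (fun i => flip_frame (k' i)) -> forall x y : I -> V, lm x = lm y ->
    lm (fun i => f i (x i)) = lm (fun i => f i (y i)).
  move=> fK gK lk1 lk2 x y; have aut := lk_aut lk1; apply: spread_eq => //.
  apply: (all_spread _ (v := fun i => fv (k' i)) (c := fun i => fc (k' i))) => //.
  - by move=> i; case: (lk_src lk1 i) => -[].
  - exact: linked_spread fK gK lk1.
  - exact: (linked_spread fK gK lk2).
move=> x y; split; first exact: main lk lkf _ _.
have [lki _] := linked_inv phiK psiK lk.
have [lkfi _] := linked_inv phiK psiK lkf.
move=> /(main _ _ _ psiK phiK lki lkfi).
by rewrite !psi_phi.
Qed.

End Linked.

Local Open Scope ring_scope.

(** * Convergence of chambers *)

Lemma cvg_initial (S : choiceType) (T : topologicalType) (f : S -> T)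
    (F : set_system S) (s : S) : Filter F ->
  f @ F --> f s -> F --> (s : initial_topology f).
Proof.
move=> FF fF A; rewrite nbhsE => -[B [[B0 oB0 <-] Bs] BA].
have /fF fB : nbhs (f s) B0 by apply: open_nbhs_nbhs.
by apply: (@filterS _ F FF _ _ _ fB) => x Bx; exact: BA.
Qed.

Lemma cvg_ultra (S : Type) (T : topologicalType) (F : set_system S) (f : S -> T) (l : T) :
  Filter F ->
  (forall W : set_system S, UltraFilter W -> F `<=` W -> f @ W --> l) -> f @ F --> l.
Proof.
move=> FF Wl A nA; apply: contrapT => FA.
have FP : ProperFilter (within (~` (f @^-1` A)) F).
  apply: Build_ProperFilter_ex => B; rewrite /within /= => FB.
  apply: contrapT => no; apply: FA; apply: filterS FB => x nB.
  by apply: contrapT => nAx; apply: no; exists x; exact: nB.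
have [W [WU sW]] := ultraFilterLemma FP.
have FW : F `<=` W by move=> B FB; apply: sW; apply: filterS FB => x.
have WA := Wl W WU FW A nA.
have WnA : W (~` (f @^-1` A)) by apply: sW; exact: withinT.
have : W (f @^-1` A `&` ~` (f @^-1` A)) by exact: filterI.
by rewrite setICr => /filter_not_empty.
Qed.

Section MetricLemmas.
Variables (R : realType) (T : topologicalType) (d : T -> T -> R).
Hypothesis dT : metrizes d.

Lemma metric_ball (x : T) (e : R) : 0 < e -> nbhs x [set y | d x y < e].
Proof. by have [_ nb] := dT => e0; apply/nb; exists e. Qed.

Lemma metric_hausdorff : hausdorff_space T.
Proof.
move=> p q pq; have [[d0 deq dC dtri] _] := dT.
apply/deq; apply/eqP; rewrite eq_le d0 andbT leNgt; apply/negP => e0.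
have e2 : 0 < d p q / 2 by apply: divr_gt0.
have [x [/= px qx]] := pq _ _ (metric_ball p e2) (metric_ball q e2).
have := dtri p x q; rewrite (dC x q) leNgt => /negP; apply.
by rewrite [ltRHS](splitr (d p q)); exact: ltrD.
Qed.

Lemma metric_lim (I : Type) (U : set_system I) (x y : I -> T) (a b : T) (e : R) :
  ProperFilter U -> x @ U --> a -> y @ U --> b ->
  (\forall i \near U, e <= d (x i) (y i)) -> e <= d a b.
Proof.
move=> UU xa yb exy; have [[d0 deq dC dtri] _] := dT.
rewrite leNgt; apply/negP => ab.
have e2 : 0 < (e - d a b) / 2 by apply: divr_gt0; rewrite ?subr_gt0.
have /filter_ex[i [e_xy []]] : \forall i \near U,
    e <= d (x i) (y i) /\ d a (x i) < (e - d a b) / 2 /\ d b (y i) < (e - d a b) / 2.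
  have xa' := xa _ (metric_ball a e2); have yb' := yb _ (metric_ball b e2).
  by apply: filterS3 exy xa' yb' => i.
move=> dx dy; have := dtri (x i) a (y i); have := dtri a b (y i).
by rewrite (dC (x i) a); lra.
Qed.

End MetricLemmas.

Section Chambers.
Variables (V : topologicalType) (G : typed_graph V) (m : nat).
Hypothesis H : compact_building G m.
Notation adj := (adj G).

Definition pair_ty (t : bool) (x y : V) : V * V := if t then (y, x) else (x, y).

Lemma sort_by_typeE (x y : V) : sort_by_type G (x, y) = pair_ty (ty G x) x y.
Proof. by []. Qed.

Lemma sort_by_typeC (x y : V) : adj x y ->
  sort_by_type G (x, y) = sort_by_type G (y, x).
Proof.
by move=> /adj_ty; rewrite !sort_by_typeE /pair_ty; case: (ty G x); case: (ty G y).
Qed.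

Lemma chamber_inj (X Y : chamber G) : val X = val Y -> X = Y.
Proof. exact: val_inj. Qed.

Lemma chamberP (X : chamber G) : [/\ ty G (val X).1 = false,
  ty G (val X).2 = true & adj (val X).1 (val X).2].
Proof. exact: set_mem (valP X). Qed.

Lemma edge_chamber (x y : V) : adj x y ->
  exists X : chamber G, val X = sort_by_type G (x, y).
Proof.
move=> xy; suff h : sort_by_type G (x, y) \in chamber_set G.
  by exists (exist _ (sort_by_type G (x, y)) h).
apply/mem_set; have := adj_ty xy; rewrite sort_by_typeE /pair_ty.
by case tx : (ty G x); case ty : (ty G y) => //= _; split=> //; rewrite adj_sym.
Qed.

Lemma chamber_sort (X : chamber G) : val X = sort_by_type G ((val X).1, (val X).2).
Proof.
by have [t _ _] := chamberP X; rewrite sort_by_typeE t /pair_ty -surjective_pairing.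
Qed.

Definition other (v : V) (X : chamber G) : V :=
  if v == (val X).1 then (val X).2 else (val X).1.

Lemma otherP (v : V) (X : chamber G) : has_vertex v X ->
  adj v (other v X) /\ val X = sort_by_type G (v, other v X).
Proof.
have [t1 t2 a] := chamberP X; rewrite /has_vertex /other.
case: eqVneq => [-> _|_ /= /eqP ->]; first by split; last exact: chamber_sort.
by rewrite adj_sym; split=> //; rewrite -sort_by_typeC //; exact: chamber_sort.
Qed.

Lemma sort_vertex (X : chamber G) (x y : V) : adj x y ->
  val X = sort_by_type G (x, y) -> has_vertex x X /\ other x X = y.
Proof.
move=> xy; have [t1 t2 _] := chamberP X; have := adj_ty xy.
rewrite sort_by_typeE /pair_ty /has_vertex /other.
case tx : (ty G x) => nty XE; rewrite XE /= ?eqxx ?orbT; split=> //.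
by case: eqVneq => // xy'; rewrite xy' in nty tx; rewrite tx in nty.
Qed.

Lemma other_inj (v : V) (X Y : chamber G) : has_vertex v X -> has_vertex v Y ->
  other v X = other v Y -> X = Y.
Proof.
move=> /otherP[_ XE] /otherP[_ YE] E; apply: chamber_inj.
by rewrite XE YE E.
Qed.

Lemma chamber_map_sort (f : automorphism G) (X : chamber G) (x y : V) : adj x y ->
  val X = sort_by_type G (x, y) ->
  val (chamber_map f X) = sort_by_type G (val f x, val f y).
Proof.
move=> xy XE; have fxy : adj (val f x) (val f y).
  by have [_ ->] : is_automorphism G (val f) := set_mem (valP f).
rewrite /chamber_map /= XE [sort_by_type G (x, y)]sort_by_typeE /pair_ty.
by case: (ty G x) => //=; rewrite (sort_by_typeC fxy).
Qed.

Lemma nbhs_chamber (W : chamber G) (t : bool) (x y : V) (N : set (chamber G)) :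
  val W = pair_ty t x y -> nbhs W N ->
  exists A B : set V, [/\ nbhs x A, nbhs y B & forall Z x' y',
    A x' -> B y' -> val Z = pair_ty t x' y' -> N Z].
Proof.
move=> WE nN.
have [N1 [[N0 oN0 <-] N0W] NN] : exists2 B, open_nbhs W B & B `<=` N.
  by move: nN; rewrite nbhsE.
have : nbhs (pair_ty t x y) N0 by rewrite -WE; apply: open_nbhs_nbhs.
rewrite /pair_ty; case: (t) => -[[A B] [/= nA nB] AB].
  exists B, A; split; [exact: nB|exact: nA|] => Z x' y' Bx' Ay' ZE; apply: NN => /=.
  by rewrite /set_val /= /eqincl ZE; apply: AB.
exists A, B; split; [exact: nA|exact: nB|] => Z x' y' Ax' By' ZE; apply: NN => /=.
by rewrite /set_val /= /eqincl ZE; apply: AB.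
Qed.

Section Nets.
Variables (I : Type) (U : set_system I).
Hypothesis UU : UltraFilter U.
Notation lm := (ulim H UU).

Lemma chamber_cvg (Z : I -> chamber G) (W : chamber G) (x y : I -> V) :
  (forall i, val (Z i) = sort_by_type G (x i, y i)) ->
  val W = sort_by_type G (lm x, lm y) -> Z @ U --> W.
Proof.
move=> ZE WE N nN; have [A [B [nA nB AB]]] := nbhs_chamber WE nN.
apply: filterS3 (lm_nbhs nA) (lm_nbhs nB) (lm_ty H UU x) => i Ai Bi tx.
by apply: (AB _ (x i) (y i)) => //; rewrite ZE sort_by_typeE tx.
Qed.

Lemma chamber_lm (Z : I -> chamber G) (W : chamber G) : Z @ U --> W ->
  lm (fun i => (val (Z i)).1) = (val W).1 /\ lm (fun i => (val (Z i)).2) = (val W).2.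
Proof.
move=> ZW; have val_cvg : (fun i => val (Z i)) @ U --> val W.
  move=> N nN.
  exact: (ZW _ (@initial_continuous _ _ (set_val : chamber G -> V * V) W N nN)).
by split; apply: lm_eq; apply: cvg_comp val_cvg _; [exact: cvg_fst|exact: cvg_snd].
Qed.

End Nets.
End Chambers.

(** * Opposite chambers and apartments *)

Section Opposite.
Variables (V : topologicalType) (G : typed_graph V) (m : nat).
Hypothesis m_ge3 : (2 < m)%N.
Hypothesis poly : polygon G m.
Notation adj := (adj G).
Notation dist := (dist G).
Let conn := polygon_conn poly.
Let dC := distC conn.

Lemma share_vertex (x : V) (X Y : chamber G) : has_vertex x X -> has_vertex x Y ->
  chamber_adj X Y.
Proof.
have [t1 t2 _] := chamberP X; have [u1 u2 _] := chamberP Y.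
rewrite /has_vertex /chamber_adj => /orP[] /eqP xX /orP[] /eqP xY; apply/orP.
- by left; rewrite -xX -xY.
- by rewrite -xX xY u2 in t1.
- by rewrite -xX xY u1 in t2.
by right; rewrite -xX -xY.
Qed.

Lemma walk_gallery k (x y : V) (X Y : chamber G) :
  has_vertex x X -> has_vertex y Y -> walk G k x y -> gallery k.+1 X Y.
Proof.
move=> xX; elim: k y Y => [|k IH] y Y yY.
  move=> xy; rewrite -xy in yY; exists [:: Y]; split=> //=.
  by rewrite (share_vertex xX yY).
move=> [z xz zy]; have [Z ZE] := edge_chamber zy.
have [zZ oZ] := sort_vertex zy ZE.
have yz : adj y z by rewrite adj_sym.
have [yZ _] : has_vertex y Z /\ other y Z = z.
  by apply: sort_vertex => //; rewrite ZE sort_by_typeC.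
have [s [ps ls ss]] := IH z Z zZ xz.
exists (rcons s Y); rewrite rcons_path last_rcons size_rcons ps ls ss.
by rewrite (share_vertex yZ yY).
Qed.

Lemma opposite_dist (X Y : chamber G) (x y : V) : opposite m X Y ->
  has_vertex x X -> has_vertex y Y -> (m.-1 <= dist x y)%N.
Proof.
move=> [_ XY] xX yY; have [xy _] := distP conn x y.
by have := XY (dist x y).+1; rewrite leqNgt => no; apply/negP => lt; apply: no;
  [lia|exact: walk_gallery xX yY xy].
Qed.

(** All distances between vertices of X and vertices of Y are m - 1 or m, and the
    types decide which. *)
Lemma opposite_vertices (X Y : chamber G) (v : bool -> V) : opposite m X Y ->
  (forall i, has_vertex (v i) X) -> adj (v false) (v true) ->
  exists vo : bool -> V, forall i,
    [/\ has_vertex (vo i) Y, dist (v i) (vo i) = m & adj (vo i) (vo (~~ i))].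
Proof.
move=> XY vX v01; have [_ _ ab] := chamberP Y.
set a := (val Y).1 in ab *; set b := (val Y).2 in ab *.
have ba : adj b a by rewrite adj_sym.
have aY : has_vertex a Y by rewrite /has_vertex eqxx.
have bY : has_vertex b Y by rewrite /has_vertex eqxx orbT.
have b0a := opposite_dist XY (vX false) aY; have b0b := opposite_dist XY (vX false) bY.
have b1a := opposite_dist XY (vX true) aY; have b1b := opposite_dist XY (vX true) bY.
have le := dist_le m_ge3 poly.
have l0a := le (v false) a; have l0b := le (v false) b.
have l1a := le (v true) a; have l1b := le (v true) b.
have sa := dist_step conn a v01; have sb := dist_step conn b v01.
have s0 := dist_step conn (v false) ab; rewrite ![dist _ (v false)]dC in s0.
have [E|E] := eqVneq (dist (v false) a) m.
  by exists (fun i => if i then b else a) => -[]; split=> //=; lia.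
by exists (fun i => if i then a else b) => -[]; split=> //=; lia.
Qed.

Section Apartment.
Variables (A : seq V) (v c : V).
Hypothesis A_circuit : circuit G m.*2 A.
Hypothesis vc : adj v c.
Hypothesis Avc : circuit_simplex A [set v; c].

Lemma apartment_start : exists q, [/\ circuit G m.*2 [:: v, c & q],
  forall s, circuit_simplex A s -> circuit_simplex [:: v, c & q] s &
  forall d, adj v d -> circuit_simplex A [set v; d] -> d <> c ->
    d = nth v [:: v, c & q] m.*2.-1].
Proof.
have [q [cq sq]] := circuit_start A_circuit Avc vc.
have [_ uq zq] := cq; exists q; split=> // d vd Avd dc.
have idx i : (i < m.*2)%N -> v = nth v [:: v, c & q] i -> i = 0%N.
  move=> im; rewrite -[v in LHS]/(nth v [:: v, c & q] 0) => /eqP.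
  by rewrite nth_uniq ?zq //; [move=> /eqP|lia].
have [i] := circuit_simplex_edge uq (adj_neq vd) (sq _ Avd).
rewrite zq => im [[vi di]|[di vi]].
  by case: dc; rewrite di (idx i).
have [i1|i1] := ltnP i.+1 m.*2; first by have := idx _ i1 vi.
by rewrite di; congr nth; lia.
Qed.

Lemma apartment_nbr_uniq (d d' : V) : adj v d -> adj v d' ->
  circuit_simplex A [set v; d] -> circuit_simplex A [set v; d'] ->
  d <> c -> d' <> c -> d = d'.
Proof.
move=> vd vd' Ad Ad' dc d'c; have [q [_ _ qd]] := apartment_start.
by rewrite (qd d) // (qd d').
Qed.

(** The apartment lists v, c, ..., vo, co, ..., d with vo in position m. *)
Lemma apartment_pr (d vo co : V) : adj v d -> circuit_simplex A [set v; d] ->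
  d <> c -> adj vo co -> circuit_simplex A [set vo; co] ->
  dist v vo = m -> dist c co = m -> d = pr G v co.
Proof.
move=> vd Ad dc vco Avco v_vo c_co; have [q [cq sq qd]] := apartment_start.
have [_ uq zq] := cq.
have dE := qd d vd Ad dc.
have bnd i j : (i <= j)%N -> (j <= m.*2)%N ->
    (dist (nth v [:: v, c & q] i) (nth v [:: v, c & q] j) <= j - i)%N.
  move=> ij jm; apply: (dist_walk conn).
  by have := @circuit_walk _ G m.*2 v (c :: q) i (j - i) cq; rewrite subnKC //; apply.
have nthN : nth v [:: v, c & q] m.*2 = v by rewrite nth_default ?zq.
have voE i : (i <= m.*2)%N -> vo = nth v [:: v, c & q] i -> i = m.
  move=> im voi; have := bnd 0%N i (leq0n i) im; have := bnd i m.*2 im (leqnn _).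
  by rewrite nthN -voi [dist vo v]dC /= v_vo; lia.
have coE i : (i <= m.*2)%N -> co = nth v [:: v, c & q] i -> (m < i)%N.
  move=> im coi; have := bnd 1%N i; rewrite -coi /= c_co.
  by case: i im coi => [_ coi|i im _]; [|lia];
    have := bnd 0%N 1%N isT; rewrite /= -[v]/(nth v [:: v, c & q] 0) -coi dC c_co; lia.
have cv : adj c v by rewrite adj_sym.
apply: esym; apply: (prM_uniq m_ge3 poly) => //; first exact: opp_adj c_co cv.
have [i] := circuit_simplex_edge uq (adj_neq vco) (sq _ Avco).
rewrite zq => im [[voi coi]|[coi voi]]; last first.
  by have := coE i (ltnW im) coi; have := voE i.+1 im voi; lia.
have mi := voE i (ltnW im) voi; rewrite mi in coi.
by have := bnd m.+1 m.*2.-1; rewrite -dE -coi dC; lia.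
Qed.

End Apartment.
End Opposite.

Lemma compact_polygon_building (R : realType) (V : topologicalType)
    (G : typed_graph V) (m : nat) : (2 < m)%N -> compact_polygon G R m ->
  thick G -> compact_building G m.
Proof.
move=> m3 [poly cV [dV dVm] cG] thG; split=> //; first exact: metric_hausdorff dVm.
move=> x a b; have [s [us ss vs]] := thG x.
case: s us ss vs => [|X [|Y [|Z []]]] //= + _.
rewrite !inE negb_or andbT => /andP[/andP[/eqP XY /eqP XZ] /eqP YZ].
move=> /and4P[vX vY vZ _].
have [aX _] := otherP vX; have [aY _] := otherP vY; have [aZ _] := otherP vZ.
have nXY : other x X <> other x Y by move=> /(other_inj vX vY).
have nXZ : other x X <> other x Z by move=> /(other_inj vX vZ).
have nYZ : other x Y <> other x Z by move=> /(other_inj vY vZ).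
have [|Xab] := pselect (other x X <> a /\ other x X <> b).
  by move=> []; exists (other x X).
have [|Yab] := pselect (other x Y <> a /\ other x Y <> b).
  by move=> []; exists (other x Y).
exists (other x Z); split=> // E.
  move: Xab Yab; rewrite -E => /not_andP[/contrapT //|/contrapT Xb].
  by move=> /not_andP[/contrapT //|/contrapT Yb]; apply: nXY; rewrite Xb.
move: Xab Yab; rewrite -E => /not_andP[/contrapT Xa|/contrapT //].
by move=> /not_andP[/contrapT Ya|/contrapT //]; apply: nXY; rewrite Xa.
Qed.

(** * Limits of topological automorphisms *)

Section Action.
Variables (V : topologicalType) (G : typed_graph V).

Definition autfun (p : Auttop G) : V -> V :=
  val (val (p : set_type (@bicontinuous_automorphism V G))).

Lemma autfunP (p : Auttop G) : is_automorphism G (autfun p).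
Proof. exact: set_mem (valP (val (p : set_type (@bicontinuous_automorphism V G)))). Qed.

Lemma autinv_ex (p : Auttop G) :
  exists g, cancel (autfun p) g /\ cancel g (autfun p).
Proof. by have [[g fK gK] _] := autfunP p; exists g. Qed.

Definition autinv (p : Auttop G) : V -> V := sval (cid (autinv_ex p)).

Lemma autfunK (p : Auttop G) : cancel (autfun p) (autinv p).
Proof. by rewrite /autinv; case: cid => g []. Qed.

Lemma autinvK (p : Auttop G) : cancel (autinv p) (autfun p).
Proof. by rewrite /autinv; case: cid => g []. Qed.

Lemma act_sort (p : Auttop G) (X : chamber G) (x y : V) : adj G x y ->
  val X = sort_by_type G (x, y) ->
  val (act p X) = sort_by_type G (autfun p x, autfun p y).
Proof. exact: chamber_map_sort. Qed.

End Action.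

Section Limits.
Variables (R : realType) (V : topologicalType) (G : typed_graph V) (m : nat).
Hypothesis H : compact_building G m.
Let m_ge3 := cb_m H.
Let poly := cb_polygon H.
Variable rho : chamber G -> chamber G -> R.
Hypothesis rhoP : metrizes rho.
Notation adj := (adj G).
Notation dist := (dist G).

Variables (I : Type) (U : set_system I).
Hypothesis UU : UltraFilter U.
Variable g : I -> Auttop G.
Notation lm := (ulim H UU).
Let phi i := autfun (g i).
Let hat (x : V) : V := lm (fun i => phi i x).

Lemma hat_adj (x y : V) : adj x y -> adj (hat x) (hat y).
Proof.
move=> xy; apply: lm_adj; apply: nearW => i.
by have [_ ->] := autfunP (g i).
Qed.

Lemma act_cvg (X : chamber G) (x : V) : has_vertex x X ->
  exists W : chamber G, [/\ has_vertex (hat x) W, other (hat x) W = hat (other x X) &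
    (fun i => act (g i) X) @ U --> W].
Proof.
move=> xX; have [xy XE] := otherP xX.
have hxy := hat_adj xy; have [W WE] := edge_chamber hxy.
have [vW oW] := sort_vertex hxy WE; exists W; split=> //.
by apply: chamber_cvg WE => i; exact: act_sort.
Qed.

Lemma hat_neq (X Y : chamber G) (x : V) (eps : R) : 0 < eps ->
  has_vertex x X -> has_vertex x Y ->
  (\forall i \near U, eps <= rho (act (g i) X) (act (g i) Y)) ->
  hat (other x X) <> hat (other x Y).
Proof.
move=> e0 xX xY XY E; have [W [vW oW cW]] := act_cvg xX.
have [Z [vZ oZ cZ]] := act_cvg xY.
have WZ : W = Z by apply: (other_inj vW vZ); rewrite oW oZ.
have := metric_lim rhoP (@ultra_proper _ _ UU) cW cZ XY.
have [[_ deq _ _] _] := rhoP; rewrite WZ (proj2 (deq Z Z) erefl) leNgt.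
by move=> /negP n; exact: n e0.
Qed.

(** The limit chambers are opposite, being in A and in B, so that the distance of
    the limit vertices is m - 1 or m, and its parity is that of m. *)
Lemma hat_opp (X Y : chamber G) (A B : set (chamber G)) (x y : V) :
  closed A -> closed B -> (forall X Y, A X -> B Y -> opposite m X Y) ->
  has_vertex x X -> has_vertex y Y -> dist x y = m ->
  (\forall i \near U, A (act (g i) X) /\ B (act (g i) Y)) ->
  dist (hat x) (hat y) = m.
Proof.
move=> cA cB AB xX yY xy XY; have [W [vW _ cW]] := act_cvg xX.
have [Z [vZ _ cZ]] := act_cvg yY.
have AW : A W by apply: (closed_cvg A cA _ W cW); apply: filterS XY => i [].
have BZ : B Z by apply: (closed_cvg B cB _ Z cZ); apply: filterS XY => i [].
have := opposite_dist m_ge3 poly (AB W Z AW BZ) vW vZ.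
move=> /(lm_dist (H := H) (UU := UU)) E.
apply: (@near_const _ U _ UU); apply: filterS E => i <-.
by rewrite (dist_aut poly (autfunP (g i))).
Qed.

(** When X is close to other x Q and its image is close to the limit of the images
    of other x P, the chamber {x, X} is close to Q and its image is close to that
    of P. *)
Lemma separated_half (P Q : chamber G) (x : V) (eps : R) : 0 < eps ->
  has_vertex x P -> has_vertex x Q ->
  (\forall i \near U, forall Z, has_vertex x Z -> rho Q Z < eps ->
     eps <= rho (act (g i) P) (act (g i) Z)) ->
  exists S T : set V, [/\ nbhs (other x Q) S, nbhs (hat (other x P)) T &
    \forall i \near U, forall X, adj x X -> ~ (S X /\ T (phi i X))].
Proof.
move=> e0 xP xQ PQ; have [xq QE] := otherP xQ.
have [A0 [S [nA0 nS A0S]]] := nbhs_chamber QE (metric_ball rhoP Q e0).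
have [W [vW oW cW]] := act_cvg xP; have [_ WE] := otherP vW; rewrite oW in WE.
have e2 : 0 < eps / 2 by apply: divr_gt0.
have [A [T [nA nT AT]]] := nbhs_chamber WE (metric_ball rhoP W e2).
exists S, T; split=> //.
have phx : \forall i \near U, A (phi i x) by exact: (lm_nbhs nA).
have tyx : \forall i \near U, ty G (phi i x) = ty G (hat x) by exact: lm_ty.
have cWi : \forall i \near U, rho W (act (g i) P) < eps / 2.
  exact: cW _ (metric_ball rhoP W e2).
near=> i => X xX [SX TX].
have [Z ZE] := edge_chamber xX; have [xZ _] := sort_vertex xX ZE.
have QZ : rho Q Z < eps by apply: A0S ZE => //; exact: nbhs_singleton nA0.
have WZ : rho W (act (g i) Z) < eps / 2.
  apply: (AT _ (phi i x) (phi i X)) => //; first by near: i.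
  rewrite (act_sort _ xX ZE) sort_by_typeE; congr pair_ty.
  by near: i.
have PZ : eps <= rho (act (g i) P) (act (g i) Z) by move: Z xZ QZ {ZE WZ}; near: i.
have WP : rho W (act (g i) P) < eps / 2 by near: i.
have [[_ _ dC dtri] _] := rhoP.
by have := dtri (act (g i) P) W (act (g i) Z); rewrite [rho _ W]dC; lra.
Unshelve. all: by end_near.
Qed.

End Limits.

(** * Compactness *)

Section JSet.
Variables (R : realType) (V : topologicalType) (G : typed_graph V) (m : nat).
Hypothesis H : compact_building G m.
Let m_ge3 := cb_m H.
Let poly := cb_polygon H.
Let conn := polygon_conn poly.
Variable rho : chamber G -> chamber G -> R.
Hypothesis rhoP : metrizes rho.
Notation adj := (adj G).
Notation dist := (dist G).
Variables C C' : chamber G.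
Hypothesis CC' : opposite m C C'.
Variable A : seq V.
Hypothesis A_circuit : circuit G m.*2 A.
Hypotheses (A_C : chamber_in A C) (A_C' : chamber_in A C').
Variable D : bool -> chamber G.
Hypothesis D_distinct : D false <> D true.
Hypothesis D_adj : forall i, [/\ chamber_in A (D i), chamber_adj C (D i) & D i <> C].
Variable v : bool -> V.
Hypothesis vP : forall i, has_vertex (v i) C /\ has_vertex (v i) (D i).
Variable E : bool -> chamber G.
Hypothesis EP : forall i, [/\ has_vertex (v i) (E i), E i <> C & E i <> D i].
Variables B B' : set (chamber G).
Hypotheses (B_closed : closed B) (B'_closed : closed B').
Hypothesis BB' : forall X Y, B X -> B' Y -> opposite m X Y.
Variable eps : R.
Hypothesis eps_gt0 : 0 < eps.

Let J := J_set rho eps C C' B B' v D E.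

Let vC i : has_vertex (v i) C. Proof. by case: (vP i). Qed.
Let vD i : has_vertex (v i) (D i). Proof. by case: (vP i). Qed.
Let vE i : has_vertex (v i) (E i). Proof. by case: (EP i). Qed.
Let d i := other (v i) (D i).
Let e i := other (v i) (E i).

Let vd i : adj (v i) (d i). Proof. by case: (otherP (vD i)). Qed.
Let ve i : adj (v i) (e i). Proof. by case: (otherP (vE i)). Qed.

Lemma chamber_in_edge (X : chamber G) (x : V) : has_vertex x X -> chamber_in A X ->
  circuit_simplex A [set x; other x X].
Proof.
rewrite /has_vertex /other /chamber_in; case: eqVneq => [-> //|_ /= /eqP ->].
by rewrite setUC.
Qed.

Lemma other_eq (X : chamber G) (x y : V) : has_vertex x X -> has_vertex y X ->
  x <> y -> other x X = y.
Proof.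
rewrite /has_vertex /other => + + /eqP xy.
case: eqVneq => [xX _|_ /= /eqP xX].
  by rewrite -xX eq_sym (negPf xy) /= => /eqP.
by rewrite -xX [y == x]eq_sym (negPf xy) orbF => /eqP.
Qed.

(** The vertex v i has only one neighbour in the apartment outside of C. *)
Lemma v_neq : v false <> v true.
Proof.
move=> v01; apply: D_distinct.
have vD1 : has_vertex (v false) (D true) by rewrite v01.
have [vc _] := otherP (vC false).
have Ac := chamber_in_edge (vC false) A_C.
have d_c i : has_vertex (v false) (D i) ->
    [/\ adj (v false) (other (v false) (D i)),
      circuit_simplex A [set v false; other (v false) (D i)] &
      other (v false) (D i) <> other (v false) C].
  move=> vDi; have [aD _ DC] := D_adj i; have [vdi _] := otherP vDi; split=> //.
    exact: chamber_in_edge.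
  by move=> /(other_inj vDi (vC false)).
have [a0 s0 n0] := d_c false (vD false); have [a1 s1 n1] := d_c true vD1.
apply: (other_inj (vD false) vD1).
by apply: (apartment_nbr_uniq _ A_circuit vc Ac).
Qed.

Lemma other_C i : other (v i) C = v (~~ i).
Proof.
by apply: other_eq => //; case: i => /=; [move=> /esym|]; exact: v_neq.
Qed.

Lemma v_adj i : adj (v i) (v (~~ i)).
Proof. by have [+ _] := otherP (vC i); rewrite other_C. Qed.

Lemma base_frames : exists vo : bool -> V, forall i,
  [/\ has_vertex (vo i) C', dist (v i) (vo i) = m, adj (vo i) (vo (~~ i)) &
      pr G (v i) (vo (~~ i)) = d i].
Proof.
have [vo voP] := opposite_vertices m_ge3 poly CC' vC (v_adj false).
exists vo => i; have [voC v_vo vo01] := voP i; have [voC1 v_vo1 _] := voP (~~ i).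
split=> //; have [aD _ DC] := D_adj i; apply: esym.
have Ac : circuit_simplex A [set v i; v (~~ i)].
  by rewrite -other_C; exact: chamber_in_edge.
have Ad : circuit_simplex A [set v i; d i] by exact: chamber_in_edge.
have Ao : circuit_simplex A [set vo i; vo (~~ i)].
  rewrite -(other_eq voC voC1); first exact: chamber_in_edge.
  exact: adj_neq vo01.
have dc : d i <> v (~~ i) by rewrite -other_C => /(other_inj (vD i) (vC i)).
exact: (apartment_pr m_ge3 poly A_circuit (v_adj i) Ac (vd i) Ad dc vo01 Ao).
Qed.

Section Base.
Variable vo : bool -> V.
Hypothesis voP : forall i,
  [/\ has_vertex (vo i) C', dist (v i) (vo i) = m, adj (vo i) (vo (~~ i)) &
      pr G (v i) (vo (~~ i)) = d i].

Definition base (i : bool) : frame V :=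
  Frame (v i) (v (~~ i)) (vo i) (vo (~~ i)) (e i) (e (~~ i)).

Lemma base_ok i : frame_ok G m (base i).
Proof.
have [_ v_vo vo01 dE] := voP i; have [_ v_vo1 _ dE1] := voP (~~ i).
rewrite negbK in dE1.
have eN j : e j <> v (~~ j) /\ e j <> d j.
  have [_ EC ED] := EP j; rewrite -other_C; split.
    by move=> /(other_inj (vE j) (vC j)).
  by move=> /(other_inj (vE j) (vD j)).
split; rewrite /= ?dE ?dE1 //; first by split=> //; exact: v_adj.
by have := eN (~~ i); rewrite negbK.
Qed.

Section Net.
Variables (I : Type) (U : set_system I).
Hypothesis UU : UltraFilter U.
Variable g : I -> Auttop G.
Hypothesis gJ : \forall i \near U, J (g i).
Notation lm := (ulim H UU).
Let phi i := autfun (g i).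
Let hat (x : V) : V := lm (fun i => phi i x).

Let rho_ge0 X Y : 0 <= rho X Y. Proof. by case: rhoP => -[]. Qed.

Let dist_to_le (X Y : chamber G) (S : set (chamber G)) : S Y -> dist_to rho X S <= rho X Y.
Proof.
move=> SY; apply: ge_inf; last by exists Y.
by exists 0 => _ [Z _ <-].
Qed.

Lemma img_base i : ulim_frame H UU (map_net phi (fun=> base i)) =
  Frame (hat (v i)) (hat (v (~~ i))) (hat (vo i)) (hat (vo (~~ i)))
    (hat (e i)) (hat (e (~~ i))).
Proof. by []. Qed.

Lemma hat_opp_v i : dist (hat (v i)) (hat (vo i)) = m.
Proof.
have [voC v_vo _ _] := voP i.
apply: (hat_opp H UU B_closed B'_closed BB' (vC i) voC v_vo).
by apply: filterS gJ => j [].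
Qed.

Lemma hat_third i : pr G (hat (v i)) (hat (vo (~~ i))) = hat (d i).
Proof.
have [_ _ _ <-] := voP i.
have v_co : dist (v i) (vo (~~ i)) = m.-1 := v_co m_ge3 poly (base_ok i).
have hv_co : dist (hat (v i)) (hat (vo (~~ i))) = m.-1.
  apply: (opp_adj m_ge3 poly (hat_opp_v (~~ i))).
  by apply: hat_adj; rewrite adj_sym; exact: v_adj.
rewrite -lm_pr //; apply: lm_near; apply: nearW => j.
by rewrite /phi (pr_aut m_ge3 poly (autfunP (g j)) v_co).
Qed.

Lemma hat_e i : hat (e i) <> hat (v (~~ i)) /\ hat (e i) <> hat (d i).
Proof.
rewrite -other_C; split; apply: nesym; apply: (hat_neq rhoP eps_gt0) => //.
  by apply: filterS gJ => j [_ _ /(_ i)[]].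
by apply: filterS gJ => j [_ _ /(_ i)[]].
Qed.

Lemma img_base_ok i : frame_ok G m (ulim_frame H UU (map_net phi (fun=> base i))).
Proof.
have [_ _ vo01 _] := voP i; have h := @hat_adj V G m H I U UU g.
rewrite img_base; split=> /=.
- by split; apply: h => //; exact: v_adj.
- exact: hat_opp_v.
- exact: hat_opp_v.
- by rewrite hat_third; exact: hat_e.
by have := hat_third (~~ i); rewrite negbK => ->; have := hat_e (~~ i); rewrite negbK.
Qed.

Lemma base_linked i : linked H UU phi (fun=> base i).
Proof.
have E0 : ulim_frame H UU (fun=> base i) = base i by exact: lmF_cst.
split.
- by move=> j; exact: autfunP.
- by move=> j; exact: base_ok.
- by rewrite E0; exact: base_ok.
- exact: img_base_ok.
have [|S1 [T1 [nS1 nT1 P1]]] := @separated_half R V G m H rho rhoP I U UU g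
    C (D i) (v i) eps eps_gt0 (vC i) (vD i).
  apply: filterS gJ => j [_ _ /(_ i)[/le_trans le_C _ _ _]] Z vZ DZ.
  by apply: le_C; apply: dist_to_le; exists Z.
have [|S2 [T2 [nS2 nT2 P2]]] := @separated_half R V G m H rho rhoP I U UU g
    (D i) C (v i) eps eps_gt0 (vD i) (vC i).
  apply: filterS gJ => j [_ _ /(_ i)[_ /le_trans le_D _ _]] Z vZ CZ.
  by apply: le_D; apply: dist_to_le; exists Z.
have [_ _ _ dE] := voP i.
rewrite other_C in nT1 nS2.
exists S2, S1, T1, T2; rewrite E0 img_base /third /= dE hat_third.
split=> //; apply: filterS2 P1 P2 => j n1 n2 X vX.
by split; [exact: n1|exact: n2].
Qed.

Lemma J_continuous (x y : I -> V) : lm x = lm y <->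
  lm (fun i => autfun (g i) (x i)) = lm (fun i => autfun (g i) (y i)).
Proof.
apply: (@linked_continuous V G m H I U UU phi (fun i => autinv (g i)) (fun=> base false)).
- by move=> i; exact: autfunK.
- by move=> i; exact: autinvK.
- exact: base_linked.
exact: (base_linked true).
Qed.

Lemma J_continuous_inv (x y : I -> V) : lm x = lm y ->
  lm (fun i => autinv (g i) (x i)) = lm (fun i => autinv (g i) (y i)).
Proof.
move=> xy; apply/J_continuous.
have fgK z : (fun i => autfun (g i) (autinv (g i) (z i))) = z.
  by apply: funext => i; rewrite autinvK.
by rewrite !fgK.
Qed.

End Net.

Section LimitAutomorphism.
Variable F : set_system (Auttop G).
Hypothesis FU : UltraFilter F.
Hypothesis FJ : F J.
Notation lm := (ulim H FU).

Definition lim_fun (x : V) : V := lm (fun p => autfun p x).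
Definition lim_inv (x : V) : V := lm (fun p => autinv p x).

Lemma lim_funK : cancel lim_fun lim_inv.
Proof.
move=> x; rewrite /lim_inv.
rewrite (J_continuous_inv (g := id) FJ (y := fun p => autfun p x)) ?lm_cst //.
rewrite (_ : (fun p => _) = (fun=> x)) ?lm_cst //.
by apply: funext => p; exact: autfunK.
Qed.

Lemma lim_invK : cancel lim_inv lim_fun.
Proof.
move=> x; rewrite /lim_fun.
have := proj1 (J_continuous FU (g := id) FJ (fun=> lim_inv x) (fun p => autinv p x)).
rewrite lm_cst => -> //.
rewrite (_ : (fun p => _) = (fun=> x)) ?lm_cst //.
by apply: funext => p; exact: autinvK.
Qed.

Lemma autinv_adj (p : Auttop G) (x y : V) : adj (autinv p x) (autinv p y) = adj x y.
Proof. by have [_ fa] := autfunP p; rewrite -fa !autinvK. Qed.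

Lemma lim_fun_adj (x y : V) : adj (lim_fun x) (lim_fun y) = adj x y.
Proof.
apply/idP/idP => xy; last exact: hat_adj.
rewrite -(lim_funK x) -(lim_funK y); apply: lm_adj; apply: nearW => p.
by rewrite autinv_adj.
Qed.

Lemma lim_fun_aut : is_automorphism G lim_fun.
Proof.
split; last exact: lim_fun_adj.
by exists lim_inv; [exact: lim_funK|exact: lim_invK].
Qed.

Lemma lim_inv_aut : is_automorphism G lim_inv.
Proof.
split; first by exists lim_fun; [exact: lim_invK|exact: lim_funK].
by move=> x y; rewrite -lim_fun_adj !lim_invK.
Qed.

(** An ultrafilter on pairs of an index and a vertex shows that the maps f p
    converge to their pointwise limit uniformly near x. *)
Lemma lim_continuous (f : Auttop G -> V -> V) :
  (forall (I : Type) (U : set_system I) (UU : UltraFilter U) (g : I -> Auttop G),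
     (\forall i \near U, J (g i)) -> forall x y : I -> V,
     ulim H UU x = ulim H UU y ->
     ulim H UU (fun i => f (g i) (x i)) = ulim H UU (fun i => f (g i) (y i))) ->
  continuous (fun x => lm (fun p => f p x)).
Proof.
move=> fJ x N nN.
have [B0 nB0 B0N] : filter_from (nbhs (lm (fun p => f p x))) closure N.
  apply: (compact_regular (cb_hausdorff H) (cb_compact H)) => //; exact: filterT.
have joint : (fun q => f q.1 q.2) @ filter_prod F (nbhs x) --> lm (fun p => f p x).
  apply: cvg_ultra => W WU sW.
  have W1 (S : set (Auttop G)) : F S -> \forall q \near W, S q.1.
    by move=> FS; apply: sW; exists (S, setT) => //=; [split=> //; exact: filterT|move=> q []].
  have W2 (S : set V) : nbhs x S -> \forall q \near W, S q.2.
    by move=> nS; apply: sW; exists (setT, S) => //=; [split=> //; exact: filterT|move=> q []].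
  have snd_x : ulim H WU (fun q => q.2) = x by apply: lm_eq => S /W2.
  have fst_x : ulim H WU (fun q => f q.1 x) = lm (fun p => f p x).
    by apply: lm_eq => S /lm_cvg /W1.
  rewrite -fst_x; have := fJ _ W WU (fun q => q.1) (W1 _ FJ) (fun q => q.2) (fun=> x).
  rewrite snd_x lm_cst => <- //; exact: lm_cvg.
have [[P Q] /= [FP nQ] PQ] := joint _ nB0.
apply: filterS nQ => y Qy; apply: B0N.
apply: (@lm_closed V G m H _ F FU (fun p => f p y) (closure B0)); first exact: closed_closure.
by apply: filterS FP => p Pp; apply: subset_closure; exact: (PQ (p, y)).
Qed.

Lemma lim_fun_continuous : continuous lim_fun.
Proof.
apply: (lim_continuous (f := @autfun _ G)) => I U UU g gJ x y.
by case: (J_continuous UU gJ x y).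
Qed.

Lemma lim_inv_continuous : continuous lim_inv.
Proof.
apply: (lim_continuous (f := @autinv _ G)) => I U UU g gJ x y.
exact: (@J_continuous_inv I U UU g gJ x y).
Qed.

Definition lim_aut : automorphism G := exist _ lim_fun (mem_set lim_fun_aut).
Definition lim_aut_inv : automorphism G := exist _ lim_inv (mem_set lim_inv_aut).

Lemma chamber_map_continuous (f : automorphism G) :
  continuous (val f : V -> V) -> continuous (chamber_map f).
Proof.
move=> fc X.
apply: (cvg_ultra (F := nbhs X) (f := chamber_map f)) => W WU WX.
have [x1 x2] := chamber_lm H WU (Z := id) (W := X) WX.
have lmf (x : chamber G -> V) : ulim H WU (fun Z => val f (x Z)) = val f (ulim H WU x).
  by apply: lm_eq => S /fc /lm_cvg.
apply: (chamber_cvg (H := H) (UU := WU) (x := fun Z => val f (val Z).1)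
  (y := fun Z => val f (val Z).2)) => [Z|].
  by have [_ _ a] := chamberP Z; exact: chamber_map_sort (chamber_sort Z).
rewrite !lmf x1 x2; have [_ _ a] := chamberP X.
exact: chamber_map_sort (chamber_sort X).
Qed.

Lemma chamber_mapK (f f' : automorphism G) : cancel (val f) (val f') ->
  cancel (chamber_map f) (chamber_map f').
Proof.
move=> fK X; apply: chamber_inj; have [_ _ a] := chamberP X.
have [_ fa] : is_automorphism G (val f) := set_mem (valP f).
have E1 := chamber_map_sort f a (chamber_sort X).
have fa' : adj (val f (val X).1) (val f (val X).2) by rewrite fa.
by rewrite (chamber_map_sort f' fa' E1) !fK -chamber_sort.
Qed.

Lemma lim_aut_bicontinuous : bicontinuous_automorphism lim_aut.
Proof.
split.
  exists lim_inv; split; [exact: lim_funK|exact: lim_invK| |].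
    exact: lim_fun_continuous.
  exact: lim_inv_continuous.
exists (chamber_map lim_aut_inv); split.
- by apply: chamber_mapK; exact: lim_funK.
- by apply: chamber_mapK; exact: lim_invK.
- by apply: chamber_map_continuous; exact: lim_fun_continuous.
- by apply: chamber_map_continuous; exact: lim_inv_continuous.
Qed.

Definition lim_auttop : Auttop G := exist _ lim_aut (mem_set lim_aut_bicontinuous).

Lemma act_net_cvg (Z : Auttop G -> chamber G) (X : chamber G) : Z @ F --> X ->
  (fun p => act p (Z p)) @ F --> act lim_auttop X.
Proof.
move=> ZX; have [x1 x2] := chamber_lm H FU ZX.
have [_ _ a] := chamberP X.
apply: (chamber_cvg (H := H) (UU := FU) (x := fun p => autfun p (val (Z p)).1)
  (y := fun p => autfun p (val (Z p)).2)) => [p|].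
  by have [_ _ b] := chamberP (Z p); exact: act_sort (chamber_sort _).
have act_lm (x : Auttop G -> V) y : lm x = y -> lm (fun p => autfun p (x p)) = lim_fun y.
  move=> xy; apply: (proj1 (J_continuous FU (g := id) FJ x (fun=> y))).
  by rewrite lm_cst.
rewrite (act_lm _ _ x1) (act_lm _ _ x2).
exact: (@act_sort _ G lim_auttop X _ _ a (chamber_sort X)).
Qed.

(** Otherwise there are chambers Z p of K whose images lie outside of N for almost
    all p, although these converge to the image of a limit of the Z p. *)
Lemma lim_auttop_cvg : F --> lim_auttop.
Proof.
apply: cvg_initial; apply/compact_open_cvgP => K N cK oN KN.
apply: contrapT => FN.
have {FN} FN : \forall p \near F, ~ (act p @` K `<=` N).
  have [//|] := in_ultra_setVsetC [set p | act p @` K `<=` N] FU.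
  by [].
have /choice[Z ZP] : forall p, exists X, ~ (act p @` K `<=` N) -> K X /\ ~ N (act p X).
  move=> p; have [|no] := pselect (exists X, K X /\ ~ N (act p X)).
    by move=> [X KX]; exists X.
  exists C => nKN; exfalso; apply: nKN => _ [X KX <-].
  by apply: contrapT => nNX; apply: no; exists X.
move: cK; rewrite compact_ultra => /(_ (Z @ F) (ultra_fmap Z FU)).
case=> [|X [KX ZX]]; first by apply: filterS FN => p /ZP[].
have NX : nbhs (act lim_auttop X) N.
  by apply: open_nbhs_nbhs; split=> //; apply: KN; exists X.
have /filter_ex[p [Np nNp]] : \forall p \near F, N (act p (Z p)) /\ ~ N (act p (Z p)).
  have FNX : \forall p \near F, N (act p (Z p)) by exact: act_net_cvg ZX _ NX.
  by apply: filterS2 FNX FN => p Np /ZP[].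
exact: nNp.
Qed.

Lemma lim_auttop_J : J lim_auttop.
Proof.
have act_c X : (fun p => act p X) @ F --> act lim_auttop X.
  by apply: act_net_cvg; exact: cvg_cst.
have rho_lim X Y : (\forall p \near F, eps <= rho (act p X) (act p Y)) ->
    eps <= rho (act lim_auttop X) (act lim_auttop Y).
  by move=> XY; exact: (metric_lim rhoP (@ultra_proper _ _ FU) (act_c X) (act_c Y) XY).
have dist_lim X Y i : has_vertex (v i) Y ->
    (\forall p \near F, eps <= dist_to rho (act p X) (act p @` panel_ball rho (v i) Y eps)) ->
    eps <= dist_to rho (act lim_auttop X) (act lim_auttop @` panel_ball rho (v i) Y eps).
  move=> vY XY; apply: lb_le_inf.
    exists (rho (act lim_auttop X) (act lim_auttop Y)); exists (act lim_auttop Y) => //.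
    by exists Y => //; split=> //; have [[_ deq _ _] _] := rhoP; rewrite (proj2 (deq Y Y)).
  move=> _ [_ [Z ZB <-] <-]; apply: rho_lim => //.
  apply: filterS XY => p /le_trans; apply; apply: ge_inf.
    by exists 0 => _ [T _ <-]; have [[d0 _ _ _] _] := rhoP.
  by exists (act p Z) => //; exists Z.
split.
- by apply: (closed_cvg B B_closed _ _ (act_c C)); apply: filterS FJ => p [].
- by apply: (closed_cvg B' B'_closed _ _ (act_c C')); apply: filterS FJ => p [].
move=> i; split.
- by apply: dist_lim => //; apply: filterS FJ => p [_ _ /(_ i)[]].
- by apply: dist_lim => //; apply: filterS FJ => p [_ _ /(_ i)[]].
- by apply: rho_lim => //; apply: filterS FJ => p [_ _ /(_ i)[]].
by apply: rho_lim => //; apply: filterS FJ => p [_ _ /(_ i)[]].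
Qed.

End LimitAutomorphism.
End Base.

Lemma J_compact : compact J.
Proof.
rewrite compact_ultra => F FU FJ; have [vo voP] := base_frames.
exists (lim_auttop voP FU FJ); split; first exact: lim_auttop_J.
exact: lim_auttop_cvg.
Qed.

End JSet.

Theorem theorem3 (R : realType) (V : topologicalType) (Delta : typed_graph V)
    (m : nat) (m_ge3 : (3 <= m)%N)
    (Delta_polygon : compact_polygon Delta R m) (Delta_thick : thick Delta)
    (rho : chamber Delta -> chamber Delta -> R) (rho_metric : metrizes rho)
    (C C' : chamber Delta) (C_opp_C' : opposite m C C')
    (A : seq V) (A_apartment : circuit Delta m.*2 A)
    (A_C : chamber_in A C) (A_C' : chamber_in A C')
    (D : bool -> chamber Delta) (D_distinct : D false <> D true)
    (D_adjacent : forall i, [/\ chamber_in A (D i), chamber_adj C (D i) & D i <> C])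
    (v : bool -> V)
    (v_common : forall i, has_vertex (v i) C /\ has_vertex (v i) (D i))
    (E : bool -> chamber Delta)
    (E_panel : forall i, [/\ has_vertex (v i) (E i), E i <> C & E i <> D i])
    (U U' : set (chamber Delta)) (U_closed : closed U) (U'_closed : closed U')
    (U_opp_U' : forall X Y, U X -> U' Y -> opposite m X Y) :
  forall eps : R, 0 < eps -> compact (J_set rho eps C C' U U' v D E).
Proof.
move=> eps eps_gt0.
have H := compact_polygon_building m_ge3 Delta_polygon Delta_thick.
exact: (J_compact H rho_metric C_opp_C' A_apartment A_C A_C' D_distinct D_adjacent
  v_common E_panel U_closed U'_closed U_opp_U' eps_gt0).
Qed.
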